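(* Let $k$ be a field, $U$ a $4$-dimensional $k$-vector space, $P=\mathrm{Sym}_\bullet U$, $\Phi_3\in D_3U^*$, and $\mathfrak A=P/\operatorname{ann}\Phi_3$. Assume that $\operatorname{ann}\Phi_3$ contains no nonzero linear form and that $x\in U$ is a weak Lefschetz element on $\mathfrak A$. Fix $x^*\in U^*$ with $x^*(x)=1$, put $U_0=\ker x^*$, fix a basis $y,z,w$ of $U_0$, and let $p,f_{1,1},f_{1,2},\mathcal A,\mathcal B,\mathcal C,\mathcal D$ be the maps defined in the context. Then the ideal $\operatorname{ann}\Phi_3$ is generated by $$\{x^2p^{-1}(\nu)\mid \nu\in U_0^*\}\cup\{u_2-x\,p^{-1}(u_2\Phi_3)\mid u_2\in\mathrm{Sym}_2U_0\}.$$ Furthermore, $$0\to F_4\xrightarrow{\tilde d_4}F_3\xrightarrow{\tilde d_3}F_2\xrightarrow{\tilde d_2}F_1\xrightarrow{\tilde d_1}F_0$$ is a homogeneous resolution of $P/\operatorname{ann}\Phi_3$ by free $P$-modules, where $F_4=P$, $F_3=(P\otimes U_0)\oplus(P\otimes D_2U_0^* )$, $F_2=\big(P\otimes\ker(\mathrm{ev}:U_0\otimes U_0^*\to k)\big)\oplus\big(P\otimes\frac{U_0\otimes U_0^*}{\mathrm{ev}^*(1)}\big)$, $F_1=(P\otimes U_0^* )\oplus(P\otimes\mathrm{Sym}_2U_0)$, $F_0=P$ (with appropriate degree shifts), and $$\tilde d_4=\begin{bmatrix}x f_{1,1}^*\\ f_{1,2}^*\end{bmatrix},\quad \tilde d_3=\begin{bmatrix}\mathcal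 B^*&\mathcal D^*\\ \mathcal A^*&x^2\mathcal C^*\end{bmatrix},\quad \tilde d_2=\begin{bmatrix}\mathcal A&\mathcal B\\ x^2\mathcal C&\mathcal D\end{bmatrix},\quad \tilde d_1=\begin{bmatrix}x f_{1,1}&f_{1,2}\end{bmatrix}.$$ This resolution is minimal if and only if $\mathcal B=0$. Indeed, the minimal number of generators of $\operatorname{ann}\Phi_3$ is equal to $9-\operatorname{rank}\mathcal B$.
   Context: Setting. $\otimes=\otimes_k$, $U^*=\mathrm{Hom}_k(U,k)$. $P=\mathrm{Sym}_\bullet U$ is the standard graded polynomial ring and $D_\bullet U^*$ is the divided power algebra, with $D_iU^*=\mathrm{Hom}_k(\mathrm{Sym}_iU,k)$. $D_\bullet U^*$ is a $P$-module: for $u\in\mathrm{Sym}_aU$, $\nu\in D_bU^*$, $u\nu=u(\nu)\in D_{b-a}U^*$ is given by $(u\nu)(u')=\nu(uu')$ for $u'\in\mathrm{Sym}_{b-a}U$ (and $u\nu=0$ if $a>b$). $\operatorname{ann}\Phi=\{f\in P: f\Phi=0\}$. An element $\ell\in U$ is a weak Lefschetz element on $\mathfrak A$ if multiplication by $\ell$, $\mathfrak A_i\to\mathfrak A_{i+1}$, has maximal rank for every $i$. Let $p:U\to U^*$ be $p(u)=u(x\Phi_3)$; under the hypotheses it is an isomorphism. $U_0=\ker x^*$ (so $U=kx\oplus U_0$) and $U_0^*=\{f\in U^*: f(x)=0\}$; $y^*,z^*,w^*$ is the basis of $U_0^*$ dual to $y,z,w$. $\mathrm{proj}:\mathrm{Sym}_\bullet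 U\to\mathrm{Sym}_\bullet U_0$ is induced by $U=kx\oplus U_0$. For $\nu\in U_0^*$ and $a,b\in U_0$, $\nu(a\wedge b)=\nu(a)b-\nu(b)a\in U_0$. $\mathrm{ev}:U_0\otimes U_0^*\to k$ is evaluation and $\mathrm{ev}^*(1)=y\otimes y^*+z\otimes z^*+w\otimes w^*$; $\frac{U_0\otimes U_0^*}{\mathrm{ev}^*(1)}$ is the quotient by the line spanned by it. Maps (all extended $P$-linearly; $u\in U_0$, $\nu\in U_0^*$, $u_2\in\mathrm{Sym}_2U_0$): $f_{1,1}:P\otimes U_0^*\to P$, $\nu\mapsto x\,p^{-1}(\nu)$. $f_{1,2}:P\otimes\mathrm{Sym}_2U_0\to P$, $u_2\mapsto u_2-x\,p^{-1}(u_2\Phi_3)$. $\mathcal A:P\otimes \ker(\mathrm{ev})\to P\otimes U_0^*$ is induced by $u\otimes\nu\mapsto -x\otimes[u\,p^{-1}(\nu)](\Phi_3)+u\otimes\nu$ (on $\ker(\mathrm{ev})$ the values lie in $P\otimes U_0^*$). $\mathcal B:\frac{U_0\otimes U_0^*}{\mathrm{ev}^*(1)}\to U_0^*$ sends the class of $u\otimes\nu$ to $-[y\,p^{-1}((\nu(z\wedge w)u)(\Phi_3))](\Phi_3)+[z\,p^{-1}((\nu(y\wedge w)u)(\Phi_3))](\Phi_3)-[w\,p^{-1}((\nu(y\wedge z)u)(\Phi_3))](\Phi_3)$. (It is a $k$-linear map; $\operatorname{rank}\mathcal B$ is its rank.) $\mathcal C:\ker(\mathrm{ev})\to\mathrm{Sym}_2U_0$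 is induced by $u\otimes\nu\mapsto -u\cdot\mathrm{proj}(p^{-1}(\nu))$. $\mathcal D:P\otimes \frac{U_0\otimes U_0^*}{\mathrm{ev}^*(1)}\to P\otimes\mathrm{Sym}_2U_0$ sends the class of $u\otimes\nu$ to $-x\otimes w\cdot\mathrm{proj}(p^{-1}([\nu(y\wedge z)u](\Phi_3)))+x\otimes z\cdot\mathrm{proj}(p^{-1}([\nu(y\wedge w)u](\Phi_3)))-x\otimes y\cdot\mathrm{proj}(p^{-1}([\nu(z\wedge w)u](\Phi_3)))-w\otimes\nu(y\wedge z)u+z\otimes\nu(y\wedge w)u-y\otimes\nu(z\wedge w)u$. Duals $(-)^*$ of these maps are taken with respect to the perfect pairings $U_0^*\otimes U_0\to k$ (evaluation), $D_2U_0^*\otimes\mathrm{Sym}_2U_0\to k$ (evaluation), and $\ker(\mathrm{ev})\otimes\frac{U_0\otimes U_0^*}{\mathrm{ev}^*(1)}\to k$, $(u\otimes\nu)\otimes(u'\otimes\nu')\mapsto\nu(u')\nu'(u)$. So, e.g., $\mathcal B^*:U_0\to\ker(\mathrm{ev})$, $\mathcal A^*:P\otimes U_0\to P\otimes\frac{U_0\otimes U_0^*}{\mathrm{ev}^*(1)}$, $\mathcal D^*:P\otimes D_2U_0^*\to P\otimes\ker(\mathrm{ev})$, $\mathcal C^*:D_2U_0^*\to\frac{U_0\otimes U_0^*}{\mathrm{ev}^*(1)}$. *)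

(* Defs.v *)
From HB Require Import structures.
From mathcomp Require Import all_boot all_order all_algebra.
From mathcomp Require Export mpoly.

Set Implicit Arguments.
Unset Strict Implicit.
Unset Printing Implicit Defensive.

Import GRing.Theory.

Local Open Scope ring_scope.

Section Ideals.

Variables (R : comNzRingType).

Definition ideal_of (S : R -> Prop) (f : R) : Prop :=
  exists (n : nat) (c g : 'I_n -> R),
    (forall i, S (g i)) /\ f = \sum_i c i * g i.

Definition generates (S I : R -> Prop) : Prop :=
  forall f, I f <-> ideal_of S f.

Definition min_num_generators (I : R -> Prop) (n : nat) : Prop :=
  (exists g : 'I_n -> R, generates (fun f => exists i, f = g i) I) /\
  (forall (m : nat) (g : 'I_m -> R),
     generates (fun f => exists i, f = g i) I -> (n <= m)%N).

End Ideals.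

(* A map of free modules P^n -> P^m is a matrix in 'M[P]_(m, n) acting on
   column vectors.  Grading P^n by s : 'I_n -> nat means that the i-th basis
   vector has degree s i, i.e., the module is \bigoplus_i P(- s i). *)
Section FreeComplexes.

Variables (k : fieldType) (r : nat).
Local Notation P := {mpoly k[r]}.

Definition exact_at (m n p : nat) (d : 'M[P]_(m, n)) (d' : 'M[P]_(n, p)) :
    Prop :=
  forall v : 'cV[P]_n, d *m v = 0 <-> exists u : 'cV[P]_p, v = d' *m u.

Definition homogeneous_mx (m n : nat) (s : 'I_m -> nat) (t : 'I_n -> nat)
    (d : 'M[P]_(m, n)) : Prop :=
  forall i j, d i j != 0 -> (s i <= t j)%N /\ d i j \is (t j - s i).-homog.

Definition minimal_mx (m n : nat) (d : 'M[P]_(m, n)) : Prop :=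
  forall i j, (d i j)@_0%MM = 0.

(* 0 -> P^n4 -> P^n3 -> P^n2 -> P^n1 -> P -> P / I -> 0 is exact. *)
Definition free_resolution (I : P -> Prop) (n1 n2 n3 n4 : nat)
    (d1 : 'M[P]_(1, n1)) (d2 : 'M[P]_(n1, n2)) (d3 : 'M[P]_(n2, n3))
    (d4 : 'M[P]_(n3, n4)) : Prop :=
  [/\ forall f, I f <-> exists v : 'cV[P]_n1, f%:M = d1 *m v,
      exact_at d1 d2, exact_at d2 d3, exact_at d3 d4 &
      forall v : 'cV[P]_n4, d4 *m v = 0 -> v = 0].

Definition minimal_complex (n1 n2 n3 n4 : nat)
    (d1 : 'M[P]_(1, n1)) (d2 : 'M[P]_(n1, n2)) (d3 : 'M[P]_(n2, n3))
    (d4 : 'M[P]_(n3, n4)) : Prop :=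
  [/\ minimal_mx d1, minimal_mx d2, minimal_mx d3 & minimal_mx d4].

(* Degrees of the basis of P(-a)^m (+) P(-b)^n. *)
Definition shifts (m n a b : nat) : 'I_(m + n) -> nat :=
  fun i => if (i < m)%N then a else b.

End FreeComplexes.

(* Sym_. U is realised as the polynomial ring on the library's basis
   vbasis {:U}; lin is the inclusion U = Sym_1 U -> Sym_. U. *)
Section SymmetricAlgebra.

Variables (k : fieldType) (U : vectType k).
Local Notation P := {mpoly k[\dim {: U}]}.

Definition lin (u : U) : P := \sum_i coord (vbasis {: U}) i u *: 'X_i.

(* D_. U^* is viewed inside Hom_k (P, k) as the graded dual: an element of
   D_i U^* = Hom_k (Sym_i U, k) is extended by 0 to the other degrees. *)
Definition in_D (i : nat) (phi : {scalar P}) : Prop :=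
  forall (d : nat) (f : P), f \is d.-homog -> d != i -> phi f = 0.

Definition contract (f : P) (phi : P -> k) : P -> k := fun g => phi (f * g).

Definition ann (phi : P -> k) (f : P) : Prop :=
  forall g, contract f phi g = 0.

(* Component of phi in D_1 U^* = U^*. *)
Definition degree1 (phi : P -> k) : 'Hom(U, k^o) :=
  linfun (fun u => phi (lin u) : k^o).

(* Multiplication by l from (P/I)_i to (P/I)_(i+1) has maximal rank, i.e., is
   injective or surjective, for every i (I a homogeneous ideal). *)
Definition weak_Lefschetz (I : P -> Prop) (l : U) : Prop :=
  forall i : nat,
    (forall f : P, f \is i.-homog -> I (lin l * f) -> I f) \/
    (forall g : P, g \is i.+1.-homog ->
       exists2 f : P, f \is i.-homog & I (g - lin l * f)).

End SymmetricAlgebra.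

Section Maps.

Variables (k : fieldType) (U : vectType k).
Local Notation P := {mpoly k[\dim {: U}]}.

Variables (x y z w : U) (Phi : P -> k).

Definition p_map : 'Hom(U, 'Hom(U, k^o)) :=
  linfun (fun u => degree1 (contract (lin u) (contract (lin x) Phi))).

Definition p_inv : 'Hom('Hom(U, k^o), U) := (p_map^-1)%VF.

(* y, z, w, and the elements y^*, z^*, w^* of U_0^* = {f in U^* | f x = 0}. *)
Definition basU0 (i : 'I_3) : U := tnth [tuple y; z; w] i.

Definition dualU0 (i : 'I_3) : 'Hom(U, k^o) :=
  linfun (fun u => coord [tuple x; y; z; w] (lift ord0 i) u : k^o).

(* Sym_. U_0 is the polynomial ring {mpoly k[3]} on y, z, w.  projU0 is the
   composite of U = Sym_1 U and proj, with kernel the line of x; inclU0 is the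
   inclusion of Sym_. U_0 in Sym_. U. *)
Definition projU0 (u : U) : {mpoly k[3]} := \sum_i (dualU0 i u : k) *: 'X_i.

Definition inclU0 (q : {mpoly k[3]}) : P :=
  q \mPo [tuple lin (basU0 i) | i < 3].

(* The monomials y^2, yz, yw, z^2, zw, w^2: the basis used for Sym_2 U_0; the
   dual basis is used for D_2 U_0^*. *)
Definition mon2 (m : 'I_6) : 'X_{1..3} :=
  tnth [tuple (U_(0%R) + U_(0%R))%MM; (U_(0%R) + U_(1%R))%MM; (U_(0%R) + U_(2%R))%MM;
              (U_(1%R) + U_(1%R))%MM; (U_(1%R) + U_(2%R))%MM; (U_(2%R) + U_(2%R))%MM] m.

(* Coordinates of f (x) nu in P (x) U_0^*, on y^*, z^*, w^*. *)
Definition tensU0dual (f : P) (nu : 'Hom(U, k^o)) : 'cV[P]_3 :=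
  \col_i ((nu (basU0 i) : k) *: f).

(* Coordinates of f (x) q in P (x) Sym_2 U_0, for q in Sym_2 U_0. *)
Definition tensSym2 (f : P) (q : {mpoly k[3]}) : 'cV[P]_6 :=
  \col_m (q@_(mon2 m) *: f).

(* The element q Phi_3 of U^*, for q in Sym_2 U. *)
Definition act (q : P) : 'Hom(U, k^o) := degree1 (contract q Phi).

(* nu (a /\ b) *)
Definition wedge (nu : 'Hom(U, k^o)) (a b : U) : U :=
  (nu a : k) *: b - (nu b : k) *: a.

Definition f11 (nu : 'Hom(U, k^o)) : P := lin x * lin (p_inv nu).

Definition f12 (q : {mpoly k[3]}) : P :=
  inclU0 q - lin x * lin (p_inv (act (inclU0 q))).

(* Values of A, B, C, D on u (x) nu, in coordinates.  Those of A on ker(ev) lie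
   in P (x) U_0^* and those of B in U_0^*; as elements of U_0^* vanish at x,
   evaluating at y, z, w gives their coordinates on y^*, z^*, w^*. *)
Definition A_val (u : U) (nu : 'Hom(U, k^o)) : 'cV[P]_3 :=
  - tensU0dual (lin x) (act (lin u * lin (p_inv nu)))
  + tensU0dual (lin u) nu.

Definition B_fun (u : U) (nu : 'Hom(U, k^o)) : 'Hom(U, k^o) :=
  let g a b c := act (lin a * lin (p_inv (act (lin (wedge nu b c) * lin u)))) in
  - g y z w + g z y w - g w y z.

Definition B_val (u : U) (nu : 'Hom(U, k^o)) : 'cV[k]_3 :=
  \col_i (B_fun u nu (basU0 i) : k).

Definition C_val (u : U) (nu : 'Hom(U, k^o)) : 'cV[k]_6 :=
  \col_m (- (projU0 u * projU0 (p_inv nu)))@_(mon2 m).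

Definition D_val (u : U) (nu : 'Hom(U, k^o)) : 'cV[P]_6 :=
  let q a b := lin (wedge nu a b) * lin u in
  let q0 a b := projU0 (wedge nu a b) * projU0 u in
  - tensSym2 (lin x) (projU0 w * projU0 (p_inv (act (q y z))))
  + tensSym2 (lin x) (projU0 z * projU0 (p_inv (act (q y w))))
  - tensSym2 (lin x) (projU0 y * projU0 (p_inv (act (q z w))))
  - tensSym2 (lin w) (q0 y z)
  + tensSym2 (lin z) (q0 y w)
  - tensSym2 (lin y) (q0 z w).

End Maps.

(* U_0 (x) U_0^* is identified with 'M[k]_3, the matrix T standing for
   \sum_(i, j) T i j (u_i (x) u_j^* ) where (u_0, u_1, u_2) = (y, z, w).  Then ev
   is the trace, ev^*(1) is the identity matrix, and the pairing
   (u (x) nu, u' (x) nu') |-> nu(u') nu'(u) is (S, T) |-> \tr (S *m T).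
   ker_ev is a basis of ker(ev); quo_ev consists of representatives of the basis
   of the quotient by ev^*(1) that is dual to ker_ev. *)
Section TensorBases.

Variable (k : fieldType).

Definition ker_ev (a : 'I_8) : 'M[k]_3 :=
  tnth [tuple delta_mx 0 1; delta_mx 0 2; delta_mx 1 0;
              delta_mx 1 2; delta_mx 2 0; delta_mx 2 1;
              delta_mx 0 0 - delta_mx 2 2; delta_mx 1 1 - delta_mx 2 2] a.

Definition quo_ev (a : 'I_8) : 'M[k]_3 :=
  tnth [tuple delta_mx 1 0; delta_mx 2 0; delta_mx 0 1;
              delta_mx 2 1; delta_mx 0 2; delta_mx 1 2;
              delta_mx 0 0; delta_mx 1 1] a.

Lemma tr_ker_ev a : \tr (ker_ev a) = 0.
Proof.
by case: a => [[|[|[|[|[|[|[|[|a]]]]]]]] lta] //;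
  rewrite /ker_ev (tnth_nth 0) /= /mxtrace !big_ord_recl big_ord0 !mxE /=;
  rewrite ?subr0 ?sub0r ?addr0 ?add0r ?subrr.
Qed.

Lemma ker_quo_ev a b : \tr (ker_ev a *m quo_ev b) = (a == b)%:R.
Proof.
have trE (i j l m : 'I_3) :
    \tr (delta_mx i j *m delta_mx l m : 'M[k]_3) = ((j == l) && (m == i))%:R.
  rewrite mul_delta_mx_cond raddfMn /= /mxtrace (bigD1 i) //= big1.
    by rewrite mxE eqxx eq_sym addr0 /=; case: (j == l); case: (m == i).
  by move=> h /negbTE ih; rewrite mxE ih.
by case: a => [[|[|[|[|[|[|[|[|a]]]]]]]] lta] //;
  case: b => [[|[|[|[|[|[|[|[|b]]]]]]]] ltb] //;
  rewrite /ker_ev /quo_ev !(tnth_nth 0) /= ?mulmxBl ?raddfB /= !trE /= ?subr0.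
Qed.

End TensorBases.

Section Differentials.

Variables (k : fieldType) (U : vectType k).
Local Notation P := {mpoly k[\dim {: U}]}.

Variables (x y z w : U) (Phi : P -> k).
Local Notation u_ := (basU0 y z w).
Local Notation nu_ := (dualU0 x y z w).

Definition f11_mx : 'M[P]_(1, 3) := \row_j f11 x Phi (nu_ j).

Definition f12_mx : 'M[P]_(1, 6) := \row_m f12 x y z w Phi 'X_[mon2 m].

Definition A_mx : 'M[P]_(3, 8) := \matrix_(i, a)
  \sum_(j < 3) \sum_(l < 3)
    ker_ev k a j l *: A_val x y z w Phi (u_ j) (nu_ l) i 0.

Definition B_mx : 'M[k]_(3, 8) := \matrix_(i, a)
  \sum_(j < 3) \sum_(l < 3)
    quo_ev k a j l * B_val x y z w Phi (u_ j) (nu_ l) i 0.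

Definition C_mx : 'M[k]_(6, 8) := \matrix_(m, a)
  \sum_(j < 3) \sum_(l < 3)
    ker_ev k a j l * C_val x y z w Phi (u_ j) (nu_ l) m 0.

Definition D_mx : 'M[P]_(6, 8) := \matrix_(m, a)
  \sum_(j < 3) \sum_(l < 3)
    quo_ev k a j l *: D_val x y z w Phi (u_ j) (nu_ l) m 0.

Local Notation toP := (map_mx (@mpolyC (\dim {: U}) k)).

(* As all bases are dual with respect to the pairings, dual maps have
   transposed matrices. *)
Definition d1_mx : 'M[P]_(1, 3 + 6) := row_mx (lin x *: f11_mx) f12_mx.

Definition d2_mx : 'M[P]_(3 + 6, 8 + 8) :=
  block_mx A_mx (toP B_mx) (lin x ^+ 2 *: toP C_mx) D_mx.

Definition d3_mx : 'M[P]_(8 + 8, 3 + 6) :=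
  block_mx (toP B_mx)^T D_mx^T A_mx^T (lin x ^+ 2 *: (toP C_mx)^T).

Definition d4_mx : 'M[P]_(3 + 6, 1) := col_mx (lin x *: f11_mx^T) f12_mx^T.

End Differentials.

(* Main.v *)
From HB Require Import structures.
Require Import Defs.
From mathcomp Require Import all_boot all_order all_algebra.
From mathcomp Require Import mpoly.
From mathcomp Require Import ring.

(* Put b(u, v) = Phi(x u v).  By the weak Lefschetz property b is nondegenerate,
   so U becomes a commutative algebra with unit x for u o v = p^-1(uv Phi), and
   multiplications are self-adjoint for b.  Modulo ann Phi one has uv = x (u o v),
   and d_1 d_2 = 0 and d_2 d_3 = 0 are identities between the multiplication
   operators; for instance A B^* + B A^* = 0 is the Jacobi identity for them.

   Exactness is reduced to the polynomial ring k[y, z, w] = P / x.  There the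
   blocks A and D become the differentials of the resolution
   0 -> R^3 -> R^8 -> R^6 -> R of R / (y, z, w)^2, which does not depend on Phi
   and is exact, with exact dual, by exactness of the Koszul complex.  Hence d_2
   and d_3 stay exact modulo x, every cycle in F_2 and F_3 is a boundary plus x
   times a cycle, and the grading finishes the proof.  At F_1 reduction modulo x
   is not exact, but the extra classes are detected by pairing with Phi.  At F_0
   one rewrites every polynomial as c + u + x u' + c' x^2 e modulo the ideal.

   For the number of generators, the only constant entries of d_2 are those of
   B: evaluating 1 = V C + d_2 W at the origin gives the lower bound, and a
   complement of the image of B provides the generators. *)

Set Implicit Arguments.
Unset Strict Implicit.
Unset Printing Implicit Defensive.

Import GRing.Theory.

Local Open Scope ring_scope.

(** Write R for P / x. In A and D the form Phi enters only through multiples of x, in B and C only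
    through constants; this is why x is the linear form to divide by. Modulo x the matrix of d_2 is
    block triangular with diagonal A_0, D_0 and the constant block B, and d_3 is its transpose up to
    the order of the blocks. The residue of A B^* + B A^* = 0 is what allows the off-diagonal block
    to be corrected.

    The obstacle is F_1: the block x f_11 of d_1 vanishes modulo x, so the part of a cycle in P (x)
    U_0^* is unconstrained there and is determined only up to the cokernel of A_0. Up to a shift
    this cokernel is the canonical module of R / (y, z, w)^2, of length four, which leaves four
    scalars to be killed.

    No step divides by an integer: quadratic forms are compared through alternating matrices, zero
    diagonal included, so the characteristic of k is arbitrary. The operator identities are proved
    for abstract data, where after expansion only commutative ring computations remain. *)

Lemma ord3_ind (Q : 'I_3 -> Prop) : Q 0 -> Q 1 -> Q 2 -> forall i, Q i.
Proof.
move=> Q0 Q1 Q2 [[|[|[|i]]] lti] //.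
- by have -> : Ordinal lti = 0 by apply/val_inj.
- by have -> : Ordinal lti = 1 by apply/val_inj.
- by have -> : Ordinal lti = 2 by apply/val_inj.
Qed.

Lemma ord3_choice (T : Type) (Q : 'I_3 -> T -> Prop) :
  (forall i, exists t, Q i t) -> exists f, forall i, Q i (f i).
Proof.
move=> Qex; have [t0 Q0] := Qex 0; have [t1 Q1] := Qex 1; have [t2 Q2] := Qex 2.
exists (fun i : 'I_3 => if i == 0 then t0 else if i == 1 then t1 else t2).
exact: ord3_ind.
Qed.

Lemma sum_ord3 (V : nmodType) (F : 'I_3 -> V) : \sum_i F i = F 0 + F 1 + F 2.
Proof.
rewrite !big_ord_recl big_ord0 addr0 addrA.
by congr (F _ + F _ + F _); apply/val_inj.
Qed.

(** Addition in ['I_3] is modulo 3, so cross products and Koszul relations have one cyclic formula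
    in i, i + 1, i + 2. These equations reduce the indices once i is specialized. *)
Lemma ord3D :
  ((0 + 1 = 1 :> 'I_3)%R * (1 + 1 = 2 :> 'I_3)%R * (2 + 1 = 0 :> 'I_3)%R *
   (0 + 2 = 2 :> 'I_3)%R * (1 + 2 = 0 :> 'I_3)%R * (2 + 2 = 1 :> 'I_3)%R)%type.
Proof. by do !split; apply/val_inj. Qed.

Lemma ord3_eq :
  (((0 == 1 :> 'I_3)%R = false) * ((1 == 0 :> 'I_3)%R = false) *
   ((0 == 2 :> 'I_3)%R = false) * ((2 == 0 :> 'I_3)%R = false) *
   ((1 == 2 :> 'I_3)%R = false) * ((2 == 1 :> 'I_3)%R = false) *
   (forall i : 'I_3, (i == i) = true))%type.
Proof. by do !split=> *; rewrite ?eqxx. Qed.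

(** * Induction on polynomials and congruence of substitutions *)

Section Induction.

Variables (k : fieldType) (n : nat).
Implicit Types p q : {mpoly k[n]}.

Lemma mpoly_ind_mulX (Q : {mpoly k[n]} -> Prop) :
    (forall c, Q c%:MP) -> (forall p q, Q p -> Q q -> Q (p + q)) ->
    (forall p i, Q p -> Q ('X_i * p)) ->
  forall p, Q p.
Proof.
move=> QC QD QX p; rewrite [p]mpolyE.
apply: (big_ind Q) => [|? ?|m _]; [by rewrite -mpolyC0 | exact: QD |].
rewrite -mul_mpolyC mulrC mpolyXE_id.
suff: forall q, Q q -> Q (\prod_(i < n) 'X_i ^+ m i * q) by apply.
apply: (big_ind (fun r => forall q, Q q -> Q (r * q))).
- by move=> q; rewrite mul1r.
- by move=> r s Qr Qs q Qq; rewrite -mulrA; apply/Qr/Qs.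
- move=> i _; elim: (m i) => [|e IHe] q Qq; first by rewrite mul1r.
  by rewrite exprS -mulrA; apply/QX/IHe.
Qed.

(** J is an ideal given by its closure properties alone, so that it can be any explicit divisibility
    statement. *)
Lemma comp_mpoly_congr (r : nat) (s t : n.-tuple {mpoly k[r]})
    (J : {mpoly k[r]} -> Prop) :
    J 0 -> (forall a b, J a -> J b -> J (a + b)) ->
    (forall a b, J b -> J (a * b)) -> (forall i, J (tnth s i - tnth t i)) ->
  forall p, J ((p \mPo s) - (p \mPo t)).
Proof.
move=> J0 JD JM Jst; elim/mpoly_ind_mulX => [c|p q Jp Jq|p i Jp].
- by rewrite !comp_mpolyC subrr.
- by rewrite !comp_mpolyD opprD addrACA; apply: JD.
- rewrite !rmorphM /= !comp_mpolyXU -!tnth_nth.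
  have -> (a b c d : {mpoly k[r]}) : a * b - c * d = b * (a - c) + c * (b - d).
    by ring.
  by apply: JD; apply: JM.
Qed.

End Induction.

(** * Exactness of the Koszul complex in three variables *)

Section Koszul.

Variable k : fieldType.
Local Notation R := {mpoly k[3]}.

(** Sets the variables in D to 0. The kernel is the ideal they generate: [killE] compares this
    substitution with the identity. *)
Let kill (D : {pred 'I_3}) : 3.-tuple R := [tuple if D i then 0 else 'X_i | i < 3].

Let killE D p (J : R -> Prop) :
  J 0 -> (forall a b, J a -> J b -> J (a + b)) ->
  (forall a b, J b -> J (a * b)) -> (forall i, i \in D -> J 'X_i) ->
  p \mPo kill D = 0 -> J p.
Proof.
move=> J0 JD JM JX Dp; have := comp_mpoly_congr (s := [tuple 'X_i | i < 3])
  (t := kill D) J0 JD JM _ p.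
rewrite comp_mpoly_id Dp subr0; apply=> i; rewrite !tnth_mktuple.
case: ifP => [/JX|]; first by rewrite subr0.
by rewrite subrr.
Qed.

Let kill_X D (i : 'I_3) : 'X_i \mPo kill D = if D i then 0 else 'X_i.
Proof. by rewrite comp_mpolyXU -tnth_nth tnth_mktuple. Qed.

Lemma mpolyX_inj (n : nat) (i : 'I_n) (a b : {mpoly k[n]}) :
  'X_i * a = 'X_i * b -> a = b.
Proof. 
apply: mulfI; apply/eqP => /(congr1 (mcoeff U_(i))).
by rewrite mcoeffXU eqxx mcoeff0 => /eqP; rewrite oner_eq0.
Qed.

(** Setting X_i to 0 leaves X_j times the residue of b, which therefore vanishes. *)
Lemma dvd_mpolyX (i j : 'I_3) (a b : R) :
  i != j -> 'X_i * a = 'X_j * b -> exists c, b = 'X_i * c.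
Proof.
move=> ij Eab; apply: (killE (D := pred1 i)) (fun b => exists c, b = 'X_i * c) _ _ _ _ _.
- by exists 0; rewrite mulr0.
- by move=> _ _ [c ->] [d ->]; exists (c + d); rewrite mulrDr.
- by move=> c _ [d ->]; exists (c * d); rewrite mulrCA.
- by move=> h /eqP ->; exists 1; rewrite mulr1.
have := congr1 (comp_mpoly (kill (pred1 i))) Eab.
rewrite !rmorphM /= !kill_X /= eqxx mul0r eq_sym (negPf ij) => E.
by apply: (@mpolyX_inj _ j); rewrite mulr0 -E.
Qed.

(** The Koszul complex where its differential is the cross product with X: dividing t_0 by X_0 gives
    c, and the other components follow by cancelling X_0. *)
Lemma koszul2 (t : 'I_3 -> R) :
    (forall i, 'X_(i + 1) * t (i + 2) = 'X_(i + 2) * t (i + 1)) ->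
  exists c, forall i, t i = 'X_i * c.
Proof.
move=> Et.
have [c tE] : exists c, t 0 = 'X_0 * c.
  by apply: (@dvd_mpolyX _ 1 (t 1)) => //; have := Et 2; rewrite !ord3D => ->.
exists c; apply: ord3_ind => //.
- apply: (@mpolyX_inj _ 0); have := Et 2; rewrite !ord3D => ->.
  by rewrite tE mulrCA.
- apply: (@mpolyX_inj _ 0); have := Et 1; rewrite !ord3D => <-.
  by rewrite tE mulrCA.
Qed.

(** The Koszul complex where its differential is the scalar product with X. Setting X_0 and X_1 to 0
    puts a_2 in (X_0, X_1), which yields two components of c; a relation between X_0 and X_1 alone
    remains, and [dvd_mpolyX] yields the third. *)
Lemma koszul1 (a : 'I_3 -> R) :
    \sum_i 'X_i * a i = 0 ->
  exists c : 'I_3 -> R,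
    forall i, a i = 'X_(i + 1) * c (i + 2) - 'X_(i + 2) * c (i + 1).
Proof.
rewrite sum_ord3 => Ea.
have [p [q a2E]] : exists p q, a 2 = 'X_0 * p + 'X_1 * q.
  apply: (killE (D := pred2 0 1)) (fun b => exists p q, b = 'X_0 * p + 'X_1 * q) _ _ _ _ _.
  - by exists 0, 0; rewrite !mulr0 addr0.
  - move=> _ _ [p [q ->]] [p' [q' ->]]; exists (p + p'), (q + q'); ring.
  - by move=> c _ [p [q ->]]; exists (c * p), (c * q); ring.
  - move=> h /pred2P[] ->; first by exists 1, 0; ring.
    by exists 0, 1; ring.
  have := congr1 (comp_mpoly (kill (pred2 0 1))) Ea.
  rewrite rmorph0 !rmorphD !rmorphM /= !kill_X /= !mul0r !add0r => E.
  by apply: (@mpolyX_inj _ 2); rewrite mulr0 -E.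
have E : 'X_0 * (a 0 + 'X_2 * p) = 'X_1 * (- (a 1 + 'X_2 * q)).
  apply/eqP; rewrite -subr_eq0 -Ea a2E; apply/eqP; ring.
have [c cE] := dvd_mpolyX (isT : 0 != 1 :> 'I_3) E.
have a0E : a 0 = 'X_1 * c - 'X_2 * p.
  apply/eqP; rewrite eq_sym subr_eq eq_sym; apply/eqP.
  by apply: (@mpolyX_inj _ 0); rewrite E cE; ring.
have a1E : a 1 = - ('X_0 * c + 'X_2 * q) by rewrite -cE; ring.
pose t : 'I_3 -> R := fun i => if i == 0 then - q else if i == 1 then p else c.
exists t; apply: ord3_ind; rewrite !ord3D /t /= ?a0E ?a1E ?a2E; ring.
Qed.

End Koszul.

(** * Homogeneous components in graded free modules *)

Section HomogeneousComponents.

Variables (k : fieldType) (r : nat).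
Local Notation P := {mpoly k[r]}.
Local Notation pi := (pihomog mdeg).

Lemma pihomogM (d N : nat) (p q : P) : p \is d.-homog ->
  pi N (p * q) = if (d <= N)%N then p * pi (N - d) q else 0.
Proof.
move=> hp; have := pihomog_partitionE (leqnn (mmeasure mdeg q)).
move: (mmeasure mdeg q) => M qE.
rewrite {1}qE mulr_sumr raddf_sum /=.
have E e : pi N (p * pi e q) = if (d + e == N)%N then p * pi e q else 0.
  have hpe : p * pi e q \is (d + e).-homog by rewrite dhomogM ?pihomogP.
  case: eqP => [<-|/eqP ne]; first by rewrite pihomog_dE.
  by rewrite (pihomog_ne0 ne).
under eq_bigr do rewrite E.
case: leqP => [dN|Nd]; last first.
  by rewrite big1 // => e _; rewrite gtn_eqF // (leq_trans Nd) ?leq_addr.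
rewrite {2}qE raddf_sum mulr_sumr /=.
apply: eq_bigr => e _; rewrite -{1}(subnKC dN) eqn_add2l.
case: eqP => [->|/eqP ne]; first by rewrite pihomog_id.
by rewrite (pihomog_ne0 ne (pihomogP _ _ _)) mulr0.
Qed.

(** The guard matters: for N < s j the truncated difference N - s j would select the constant
    term. *)
Definition hcomp (n : nat) (s : 'I_n -> nat) (N : nat) (v : 'cV[P]_n) : 'cV[P]_n :=
  \col_j (if (s j <= N)%N then pi (N - s j) (v j 0) else 0).

Lemma hcompD n (s : 'I_n -> nat) N u v :
  hcomp s N (u + v) = hcomp s N u + hcomp s N v.
Proof.
by apply/colP => j; rewrite !mxE; case: ifP => _; rewrite ?raddfD ?addr0.
Qed.

Lemma hcomp_mulmx m n (s : 'I_m -> nat) (t : 'I_n -> nat) (d : 'M[P]_(m, n)) N v :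
  homogeneous_mx s t d -> hcomp s N (d *m v) = d *m hcomp t N v.
Proof.
move=> hd; apply/colP => i; rewrite !mxE.
have E j : (if (s i <= N)%N then pi (N - s i) (d i j * v j 0) else 0) =
           d i j * hcomp t N v j 0.
  rewrite mxE; have [->|/hd[st hij]] := eqVneq (d i j) 0.
    by rewrite !mul0r raddf0 if_same.
  case: leqP => sN; last by rewrite leqNgt (leq_trans sN st) mulr0.
  rewrite (pihomogM _ _ hij) leq_sub2rE //.
  by case: ifP => _; rewrite ?mulr0 // subnBA // subnK.
under [RHS]eq_bigr do rewrite -E.
by case: ifP => _; rewrite ?raddf_sum // big1.
Qed.

Lemma hcompZ n (s : 'I_n -> nat) N (l : P) v : l \is 1.-homog ->
  hcomp s N (l *: v) = if N is N'.+1 then l *: hcomp s N' v else 0.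
Proof.
move=> hl; apply/colP => j; rewrite !mxE (pihomogM _ _ hl) subn_gt0.
case: N => [|N]; first by rewrite mxE ltn0 if_same.
rewrite !mxE ltnS; case: (leqP (s j) N) => sN; last by rewrite mulr0 if_same.
by rewrite leqW // -subnDA addn1 subSS.
Qed.

Lemma hcomp_id n (s : 'I_n -> nat) N v : hcomp s N (hcomp s N v) = hcomp s N v.
Proof.
by apply/colP => j; rewrite !mxE; case: (leqP (s j) N); rewrite ?pihomog_id.
Qed.

Lemma hcomp_sum n (s : 'I_n -> nat) v :
  exists M, v = \sum_(N < M) hcomp s N v.
Proof.
pose M := (\max_j (s j + mmeasure mdeg (v j 0)%R))%N; exists M.
apply/colP => j; rewrite summxE.
have sM : (s j + mmeasure mdeg (v j 0)%R <= M)%N by rewrite (leq_bigmax j).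
rewrite -(big_mkord xpredT (fun N => hcomp s N v j 0)).
rewrite (big_cat_nat (n := s j)) //=; last by apply: leq_trans sM; apply: leq_addr.
rewrite big_nat big1 ?add0r => [|N /andP[_ Ns]]; last by rewrite mxE leqNgt Ns.
rewrite -{1}[s j]add0n big_addn big_mkord.
rewrite [LHS](@pihomog_partitionE _ _ mdeg (M - s j)) ?leq_subRL //; last first.
  exact: leq_trans (leq_addr _ _) sM.
by apply: eq_bigr => N _; rewrite mxE leq_addl addnK.
Qed.

Lemma scale_cV_inj n (l : P) (u v : 'cV[P]_n) : l != 0 -> l *: u = l *: v -> u = v.
Proof.
move=> l0 E; apply/colP => i; apply: (mulfI l0).
by have /colP/(_ i) := E; rewrite !mxE.
Qed.

(* Graded Nakayama: the homology H of the complex satisfies H = l H, with l of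
   degree one, so it vanishes. *)
Lemma exact_at_by_division m n p (s : 'I_m -> nat) (t : 'I_n -> nat)
    (t' : 'I_p -> nat) (d : 'M[P]_(m, n)) (d' : 'M[P]_(n, p)) (l : P) :
    homogeneous_mx s t d -> homogeneous_mx t t' d' -> d *m d' = 0 ->
    l != 0 -> l \is 1.-homog ->
    (forall v : 'cV[P]_n, d *m v = 0 -> exists u v', v = d' *m u + l *: v') ->
  exact_at d d'.
Proof.
move=> hd hd' dd' l0 hl step v; split=> [dv|[u ->]]; last by rewrite mulmxA dd' mul0mx.
(* Induction on the degree of a homogeneous cycle; in degree 0 the multiple of l has no
   component. *)
have graded N : forall w : 'cV[P]_n, hcomp t N w = w -> d *m w = 0 -> exists u, w = d' *m u.
  elim: N => [|N IHN] w hw dw; have [u [w' Ew]] := step w dw.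
    exists (hcomp t' 0 u).
    by rewrite -{1}hw Ew hcompD hcompZ // addr0 (hcomp_mulmx _ _ hd').
  have Ew' : w = d' *m hcomp t' N.+1 u + l *: hcomp t N w'.
    by rewrite -{1}hw Ew hcompD hcompZ // (hcomp_mulmx _ _ hd').
  (* The quotient w' need not be homogeneous, but its component of degree N is, and it is a cycle
     because l can be cancelled. *)
  have [] := IHN (hcomp t N w'); first exact: hcomp_id.
    move: dw; rewrite Ew' mulmxDr mulmxA dd' mul0mx add0r -scalemxAr.
    by move=> E; apply: (scale_cV_inj l0); rewrite E scaler0.
  move=> u' Eu'; exists (hcomp t' N.+1 u + l *: u').
  by rewrite Ew' Eu' mulmxDr scalemxAr.
have [M ->] := hcomp_sum t v.
apply: (big_ind (fun w => exists u, w = d' *m u)).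
- by exists 0; rewrite mulmx0.
- by move=> _ _ [u ->] [u' ->]; exists (u + u'); rewrite mulmxDr.
- move=> N _; apply: (graded N); first exact: hcomp_id.
  rewrite -(hcomp_mulmx _ _ hd) dv.
  by apply/colP => j; rewrite !mxE raddf0 if_same.
Qed.

End HomogeneousComponents.

(** * The dual bases of ker(ev) and of the quotient by ev^*(1) *)

Section Casimir.

Variable k : fieldType.

(** The first term is the canonical tensor of the trace form on all 3 x 3 matrices. The correction
    reflects the choice of representatives with entry (2, 2) equal to zero; its second factor is the
    identity matrix, which is zero in the quotient. *)
Lemma casimir (i j l h : 'I_3) :
  \sum_a ker_ev k a i j * quo_ev k a l h =
  ((j == l) && (i == h))%:R - ((i == 2) && (j == 2) && (l == h))%:R.
Proof.
rewrite !big_ord_recl big_ord0 /ker_ev /quo_ev !(tnth_nth 0) /= !mxE.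
by move: i j l h; do 4!apply: ord3_ind; rewrite !ord3_eq /= ?oppr0
     ?(mul0r, mulr0, mul1r, mulr1, add0r, addr0, subrr, mulrN1, mulNr).
Qed.

Lemma sum_ker_quo (a b : 'I_8) :
  \sum_i \sum_j ker_ev k a i j * quo_ev k b j i = (a == b)%:R.
Proof.
rewrite -ker_quo_ev /mxtrace; apply: eq_bigr => i _.
by rewrite mxE.
Qed.

Variable A : comAlgType k.
Implicit Types (f g : 'I_3 -> 'I_3 -> A) (v : 'I_8 -> A).

Lemma sum_ev_mulr (M : 'I_8 -> 'M[k]_3) f v :
  \sum_a (\sum_i \sum_j M a i j *: f i j) * v a =
  \sum_i \sum_j (\sum_a M a i j *: v a) * f i j.
Proof.
under eq_bigr do rewrite mulr_suml.
rewrite exchange_big /=; apply: eq_bigr => i _.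
under eq_bigr do rewrite mulr_suml.
rewrite exchange_big /=; apply: eq_bigr => j _.
rewrite mulr_suml; apply: eq_bigr => a _.
by rewrite -!scalerAl mulrC.
Qed.

(** By duality under the trace form, pairing a tensor with one basis reads off its coordinates in
    the other. This converts between vectors in R^8 and 3 x 3 matrices. *)
Lemma ker_ev_coord v (a : 'I_8) :
  \sum_i \sum_j quo_ev k a i j *: (\sum_b ker_ev k b j i *: v b) = v a.
Proof.
transitivity (\sum_b (\sum_i \sum_j ker_ev k b j i * quo_ev k a i j) *: v b).
  under eq_bigr do under eq_bigr do rewrite scaler_sumr.
  under eq_bigr do rewrite exchange_big /=.
  rewrite exchange_big /=; apply: eq_bigr => b _.
  rewrite scaler_suml; apply: eq_bigr => i _.
  by rewrite scaler_suml; apply: eq_bigr => j _; rewrite scalerA mulrC.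
rewrite (bigD1 a) //= exchange_big /= sum_ker_quo eqxx scale1r big1 ?addr0 // => b ba.
by rewrite exchange_big /= sum_ker_quo (negPf ba) scale0r.
Qed.

Lemma quo_ev_coord v (a : 'I_8) :
  \sum_i \sum_j ker_ev k a i j *: (\sum_b quo_ev k b j i *: v b) = v a.
Proof.
transitivity (\sum_b (\sum_i \sum_j ker_ev k a i j * quo_ev k b j i) *: v b).
  under eq_bigr do under eq_bigr do rewrite scaler_sumr.
  under eq_bigr do rewrite exchange_big /=.
  rewrite exchange_big /=; apply: eq_bigr => b _.
  rewrite scaler_suml; apply: eq_bigr => i _.
  by rewrite scaler_suml; apply: eq_bigr => j _; rewrite scalerA.
rewrite (bigD1 a) //= sum_ker_quo eqxx scale1r big1 ?addr0 // => b ba.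
by rewrite sum_ker_quo eq_sym (negPf ba) scale0r.
Qed.

(** Lets a product of two matrices be computed on the tensors u_i (x) u_j^*. The condition on g says
    that g is well defined modulo ev^*(1); it removes the correction in [casimir]. *)
Lemma sum_ker_quo_ev f g : \sum_i g i i = 0 ->
  \sum_a (\sum_i \sum_j ker_ev k a i j *: f i j) *
         (\sum_i \sum_j quo_ev k a i j *: g i j) =
  \sum_i \sum_j f i j * g j i.
Proof.
move=> g0; rewrite sum_ev_mulr; apply: eq_bigr => i _; apply: eq_bigr => j _.
rewrite mulrC; congr (_ * _).
transitivity (\sum_l \sum_h (((j == l) && (i == h))%:R
                - ((i == 2) && (j == 2) && (l == h))%:R) *: g l h).
  under eq_bigr do rewrite scaler_sumr.
  rewrite exchange_big /=; apply: eq_bigr => l _.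
  under eq_bigr do rewrite scaler_sumr.
  rewrite exchange_big /=; apply: eq_bigr => h _.
  by rewrite -casimir scaler_suml; apply: eq_bigr => a _; rewrite scalerA.
under eq_bigr do under eq_bigr do rewrite scalerBl.
under eq_bigr do rewrite sumrB.
rewrite sumrB [X in _ - X](_ : _ = 0) ?subr0; last first.
  transitivity (((i == 2) && (j == 2))%:R *: \sum_l g l l); last by rewrite g0 scaler0.
  rewrite scaler_sumr; apply: eq_bigr => l _.
  rewrite (bigD1 l) //= eqxx andbT big1 ?addr0 // => h hl.
  by rewrite [l == h]eq_sym (negPf hl) andbF scale0r.
rewrite (bigD1 j) //= (bigD1 i) //= !eqxx scale1r.
rewrite !big1 ?addr0 // => [l lj|h hi].
  by rewrite big1 // => h _; rewrite [j == l]eq_sym (negPf lj) scale0r.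
by rewrite [i == h]eq_sym (negPf hi) andbF scale0r.
Qed.

(** The matrices [quo_ev] together with the identity span all matrices, and trace zero is
    orthogonality to the identity. *)
Lemma quo_ev_orthogonal f : \sum_i f i i = 0 ->
  (forall a, \sum_i \sum_j quo_ev k a i j *: f i j = 0) -> forall i j, f i j = 0.
Proof.
move=> f0 Qf i j.
pose e l h : A := ((l == j) && (h == i))%:R.
have := sum_ker_quo_ev e f0.
rewrite big1 => [|a _]; last by rewrite Qf mulr0.
rewrite (bigD1 j) //= (bigD1 i) //= /e !eqxx mul1r !big1 ?addr0 //.
- by move=> l lj; rewrite big1 // => h _; rewrite (negPf lj) mul0r.
- by move=> h hi; rewrite (negPf hi) mul0r.
Qed.

End Casimir.

(** * Indexing of the six quadratic monomials *)

Section QuadraticMonomials.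

(** The position in [mon2] of the product of the i-th and j-th variables; [fst2] and [snd2] recover
    the factors, smaller index first. *)
Definition idx2 (i j : 'I_3) : 'I_6 :=
  let o m lt_m6 := @Ordinal 6 m lt_m6 in
  tnth [tuple tnth [tuple o 0 isT; o 1 isT; o 2 isT] j;
              tnth [tuple o 1 isT; o 3 isT; o 4 isT] j;
              tnth [tuple o 2 isT; o 4 isT; o 5 isT] j] i.

Definition fst2 (m : 'I_6) : 'I_3 := tnth [tuple 0; 0; 0; 1; 1; 2%R] m.
Definition snd2 (m : 'I_6) : 'I_3 := tnth [tuple 0; 1; 2%R; 1; 2%R; 2%R] m.

Lemma ord6_ind (Q : 'I_6 -> Prop) : Q (idx2 0 0) -> Q (idx2 0 1) ->
  Q (idx2 0 2) -> Q (idx2 1 1) -> Q (idx2 1 2) -> Q (idx2 2 2) -> forall m, Q m.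
Proof.
move=> Q0 Q1 Q2 Q3 Q4 Q5 [[|[|[|[|[|[|m]]]]]] ltm] //.
- by have -> : Ordinal ltm = idx2 0 0 by apply/val_inj.
- by have -> : Ordinal ltm = idx2 0 1 by apply/val_inj.
- by have -> : Ordinal ltm = idx2 0 2 by apply/val_inj.
- by have -> : Ordinal ltm = idx2 1 1 by apply/val_inj.
- by have -> : Ordinal ltm = idx2 1 2 by apply/val_inj.
- by have -> : Ordinal ltm = idx2 2 2 by apply/val_inj.
Qed.

Lemma idx2C i j : idx2 i j = idx2 j i.
Proof. by move: i j; do 2!apply: ord3_ind; apply/val_inj. Qed.

Lemma idx2_fst_snd m : idx2 (fst2 m) (snd2 m) = m.
Proof. by move: m; apply: ord6_ind; apply/val_inj. Qed.

Lemma idx2_sym (T : Type) (F : 'I_3 -> 'I_3 -> T) :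
  (forall i j, F i j = F j i) ->
  forall i j, F (fst2 (idx2 i j)) (snd2 (idx2 i j)) = F i j.
Proof.
move=> FC; do 2!apply: ord3_ind;
  first [by congr F; apply/val_inj | by rewrite FC; congr F; apply/val_inj].
Qed.

Lemma mon2_idx2 i j : mon2 (idx2 i j) = (U_(i) + U_(j))%MM.
Proof.
rewrite /mon2; move: i j; do 2!apply: ord3_ind; rewrite (tnth_nth 0%MM) //.
all: by rewrite [RHS]addmC.
Qed.

Lemma mon2E m : mon2 m = (U_(fst2 m) + U_(snd2 m))%MM.
Proof. by rewrite -mon2_idx2 idx2_fst_snd. Qed.

Lemma mon2_inj : injective mon2.
Proof.
(* All exponents are at most 2, so as ternary digits they separate the monomials. *)
pose code (m : 'X_{1..3}) : nat := (m 0%R + 3 * m 1%R + 9 * m 2%R)%N.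
move=> m m' /(congr1 code); move: m m'; do 2!apply: ord6_ind;
  by rewrite // !mon2_idx2 /code !mnmDE !mnm1E !ord3_eq.
Qed.

Lemma eq_mon2 m i j : ((U_(i) + U_(j))%MM == mon2 m) = (m == idx2 i j).
Proof. by rewrite -mon2_idx2 (inj_eq mon2_inj) eq_sym. Qed.

End QuadraticMonomials.

Lemma koszul2_scaled (k : fieldType) (t : 'I_3 -> {mpoly k[3]}) :
  (forall i, t (i + 1) * 'X_(i + 2) = t (i + 2) * 'X_(i + 1)) ->
  exists c, forall i, t i = c * 'X_i.
Proof.
move=> Et; have [|c tE] := @koszul2 _ t.
  by move=> i; rewrite mulrC -Et mulrC.
by exists c => i; rewrite tE mulrC.
Qed.

(* The minimal resolution of k[y, z, w] / (y, z, w)^2 and its dual. *)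
Section SquareOfMaximalIdeal.

Variable k : fieldType.
Local Notation R := {mpoly k[3]}.

Definition A0_mx : 'M[R]_(3, 8) := \matrix_(p, a)
  \sum_i \sum_j ker_ev k a i j *: ((j == p)%:R * 'X_i).

(** The tautological relation X_(j+1) (X_(j+2) X_i) - X_(j+2) (X_(j+1) X_i) = 0 between quadratic
    monomials, as the image of u_i (x) u_j^*. *)
Definition D0_val (i j : 'I_3) (m : 'I_6) : R :=
  'X_(j + 1) * (m == idx2 (j + 2) i)%:R - 'X_(j + 2) * (m == idx2 (j + 1) i)%:R.

Definition D0_mx : 'M[R]_(6, 8) := \matrix_(m, a)
  \sum_i \sum_j quo_ev k a i j *: D0_val i j m.

Definition f0_mx : 'rV[R]_6 := \row_m 'X_[mon2 m].

Lemma sum_delta (V : nmodType) (n : nat) (F : 'I_n -> V) j :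
  \sum_i F i *+ (i == j) = F j.
Proof.
rewrite (bigD1 j) //= eqxx big1 ?addr0 // => i /negPf ->.
by rewrite mulr0n.
Qed.

Lemma sum_deltar (V : nmodType) (n : nat) (F : 'I_n -> V) j :
  \sum_i F i *+ (j == i) = F j.
Proof. by rewrite -[RHS](sum_delta F); under eq_bigr do rewrite eq_sym. Qed.

Lemma mul_A0_mx (v : 'cV[R]_8) p :
  (A0_mx *m v) p 0 = \sum_i 'X_i * (\sum_a ker_ev k a i p *: v a 0).
Proof.
rewrite mxE; under eq_bigr do rewrite mxE.
rewrite (sum_ev_mulr (ker_ev k) (fun i j => (j == p)%:R * 'X_i) (fun a => v a 0)).
apply: eq_bigr => i _.
rewrite (bigD1 p) //= eqxx mul1r [X in _ + X]big1 ?addr0 => [|j jp]; first by rewrite mulrC.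
by rewrite (negPf jp) mul0r mulr0.
Qed.

Lemma mul_D0_mx (v : 'cV[R]_8) m :
  (D0_mx *m v) m 0 =
  \sum_i \sum_j (\sum_a quo_ev k a i j *: v a 0) * D0_val i j m.
Proof.
rewrite mxE; under eq_bigr do rewrite mxE.
exact: (sum_ev_mulr (quo_ev k) (fun i j => D0_val i j m) (fun a => v a 0)).
Qed.

Lemma D0_val_sum (F : 'I_6 -> R) i j :
  \sum_m D0_val i j m * F m =
  'X_(j + 1) * F (idx2 (j + 2) i) - 'X_(j + 2) * F (idx2 (j + 1) i).
Proof.
under eq_bigr do rewrite mulrBl -!mulrA !mulr_natl.
by rewrite sumrB -!mulr_sumr !sum_delta.
Qed.

Lemma mul_trA0_mx (w : 'cV[R]_3) a :
  (A0_mx^T *m w) a 0 = \sum_i \sum_j ker_ev k a i j *: ('X_i * w j 0).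
Proof.
rewrite mxE; under eq_bigr do rewrite !mxE mulr_suml.
rewrite exchange_big /=; apply: eq_bigr => i _.
under eq_bigr do rewrite mulr_suml.
rewrite exchange_big /=; apply: eq_bigr => j _.
under eq_bigr do rewrite -scalerAl -mulrA mulr_natl.
by rewrite -scaler_sumr sum_deltar.
Qed.

Lemma mul_trD0_mx (w : 'cV[R]_6) a :
  (D0_mx^T *m w) a 0 = \sum_i \sum_j quo_ev k a i j *:
    ('X_(j + 1) * w (idx2 (j + 2) i) 0 - 'X_(j + 2) * w (idx2 (j + 1) i) 0).
Proof.
rewrite mxE; under eq_bigr do rewrite !mxE mulr_suml.
rewrite exchange_big /=; apply: eq_bigr => i _.
under eq_bigr do rewrite mulr_suml.
rewrite exchange_big /=; apply: eq_bigr => j _.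
under eq_bigr do rewrite -scalerAl.
by rewrite -scaler_sumr (D0_val_sum (fun m => w m 0)).
Qed.

(* The coefficient of v_i v_j in the quadratic form v^T (S [u]_x) v. *)
Definition cross_mx (S : 'I_3 -> 'I_3 -> R) i j :=
  S i (j + 1) * 'X_(j + 2) - S i (j + 2) * 'X_(j + 1).

(** Thus D_0 symmetrizes S [X]_x, and S is in its kernel when this matrix is alternating. *)
Lemma D0_val_cross (S : 'I_3 -> 'I_3 -> R) m :
  \sum_i \sum_j S i j * D0_val i j m =
  \sum_i \sum_j cross_mx S i j *+ (m == idx2 i j).
Proof.
apply: eq_bigr => i _.
under eq_bigr do rewrite /D0_val mulrBr !mulrA !mulr_natr.
under [RHS]eq_bigr do rewrite /cross_mx mulrnBl.
rewrite !sumrB !sum_ord3 !ord3D !(idx2C _ i) //; ring.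
Qed.

Lemma sum_idx2_alternating (F : 'I_3 -> 'I_3 -> R) m :
  (forall i, F i i = 0) -> (forall i j, F i j = - F j i) ->
  \sum_i \sum_j F i j *+ (m == idx2 i j) = 0.
Proof.
move=> F0 FN; rewrite !sum_ord3 !F0 (FN 1 0) (FN 2 0) (FN 2 1).
rewrite (idx2C 1 0) (idx2C 2 0) (idx2C 2 1) !mul0rn !mulNrn; ring.
Qed.

(** The coefficient of v_i^2 is a diagonal entry itself, that of v_i v_j a sum of two opposite
    entries. Hence the diagonal vanishes also in characteristic 2. *)
Lemma alternating_sum_idx2 (F : 'I_3 -> 'I_3 -> R) :
  (forall m, \sum_i \sum_j F i j *+ (m == idx2 i j) = 0) ->
  (forall i, F i i = 0) /\ (forall i j, F i j = - F j i).
Proof.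
move=> Fm.
have Fm' i j := Fm (idx2 i j).
have F0 i : F i i = 0.
  move: i; apply: ord3_ind; [move: (Fm' 0 0)|move: (Fm' 1 1)|move: (Fm' 2 2)];
  by rewrite !sum_ord3 -!val_eqE /= ?mulr0n ?mulr1n ?(add0r, addr0).
split=> // i j; apply/eqP; rewrite -addr_eq0; apply/eqP.
move: i j; do 2!apply: ord3_ind; rewrite ?F0 ?addr0 //;
 [move: (Fm' 0 1)|move: (Fm' 0 2)|move: (Fm' 0 1)|move: (Fm' 1 2)|
  move: (Fm' 0 2)|move: (Fm' 1 2)];
  by rewrite !sum_ord3 -!val_eqE /= ?mulr0n ?mulr1n ?(add0r, addr0) // addrC.
Qed.

(** The tensor of v is a traceless matrix T whose columns are orthogonal to X, so T = [X]_x c. Trace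
    zero says that the vector of the skew part of c is orthogonal to X, hence a cross product of X
    with some s; then c + X s^T is symmetric and gives the same T. *)
Lemma ker_A0_mx (v : 'cV[R]_8) : A0_mx *m v = 0 -> exists w, v = D0_mx^T *m w.
Proof.
move=> Av; pose T i j : R := \sum_a ker_ev k a i j *: v a 0.
have trT : \sum_i T i i = 0.
  rewrite exchange_big /= big1 // => a _; rewrite -scaler_suml.
  by have := tr_ker_ev k a; rewrite /mxtrace => ->; rewrite scale0r.
have colT j : exists c : 'I_3 -> R,
    forall i, T i j = 'X_(i + 1) * c (i + 2) - 'X_(i + 2) * c (i + 1).
  by apply: koszul1; rewrite -mul_A0_mx Av mxE.
have [c' cT'] := ord3_choice colT.
pose c i j := c' j i.
have cT i j : T i j = 'X_(i + 1) * c (i + 2) j - 'X_(i + 2) * c (i + 1) j.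
  exact: cT'.
have [|s sE] := @koszul1 _ (fun i => c (i + 2) (i + 1) - c (i + 1) (i + 2)).
  transitivity (- \sum_i T i i); last by rewrite trT oppr0.
  rewrite !sum_ord3 !cT !ord3D; ring.
pose C i j := c i j + 'X_i * s j.
have CC i j : C i j = C j i.
  have E0 := sE 0; have E1 := sE 1; have E2 := sE 2.
  rewrite !ord3D in E0 E1 E2.
  have F10 : c 1 0 = c 0 1 + ('X_0 * s 1 - 'X_1 * s 0) by rewrite -E2; ring.
  have F21 : c 2 1 = c 1 2 + ('X_1 * s 2 - 'X_2 * s 1) by rewrite -E0; ring.
  have F02 : c 0 2 = c 2 0 + ('X_2 * s 0 - 'X_0 * s 2) by rewrite -E1; ring.
  by rewrite /C; move: i j; do 2!apply: ord3_ind; rewrite ?F10 ?F21 ?F02; ring.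
have TC i j : T i j = 'X_(i + 1) * C (i + 2) j - 'X_(i + 2) * C (i + 1) j.
  rewrite cT /C; ring.
exists (\col_m C (fst2 m) (snd2 m)); apply/colP => a.
rewrite mul_trD0_mx -[LHS](ker_ev_coord (fun a => v a 0)).
apply: eq_bigr => i _; apply: eq_bigr => j _; congr (_ *: _).
by rewrite !mxE !(idx2_sym CC) -TC.
Qed.

(** S [X]_x is alternating and kills X, so its axial vector is t X and (S - t I) [X]_x = 0. The rows
    of S - t I are then multiples of X, and t I is zero modulo ev^*(1). *)
Lemma ker_D0_mx (v : 'cV[R]_8) : D0_mx *m v = 0 -> exists w, v = A0_mx^T *m w.
Proof.
move=> Dv; pose S i j : R := \sum_a quo_ev k a i j *: v a 0.
have [|W0 WN] := @alternating_sum_idx2 (cross_mx S).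
  by move=> m; rewrite -D0_val_cross -mul_D0_mx Dv mxE.
have crossu i : \sum_j cross_mx S i j * 'X_j = 0.
  rewrite sum_ord3 /cross_mx !ord3D; ring.
have [|t tE] := @koszul2_scaled _ (fun i => cross_mx S (i + 2) (i + 1)).
  apply: ord3_ind; rewrite !ord3D; apply: subr0_eq.
  - by move: (crossu 0); rewrite sum_ord3 W0 (WN 0 1) => E; rewrite -[RHS]E; ring.
  - by move: (crossu 1); rewrite sum_ord3 W0 (WN 1 2) => E; rewrite -[RHS]E; ring.
  - by move: (crossu 2); rewrite sum_ord3 W0 (WN 2 0) => E; rewrite -[RHS]E; ring.
have [g gE] : exists g, forall i j, S i j = t *+ (i == j) + g i * 'X_j.
  apply: (@ord3_choice R (fun i g => forall j, S i j = t *+ (i == j) + g * 'X_j)) => i.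
  have [|g gE] := @koszul2_scaled _ (fun j => S i j - t *+ (i == j)).
    have E0 := tE 0; have E1 := tE 1; have E2 := tE 2.
    rewrite !ord3D in E0 E1 E2.
    have ES j : S i (j + 1) * 'X_(j + 2) = cross_mx S i j + S i (j + 2) * 'X_(j + 1).
      by rewrite /cross_mx; ring.
    move=> j; rewrite !mulrBl ES; move: i j {ES}; do 2!apply: ord3_ind;
      rewrite !ord3D !ord3_eq ?W0 ?(WN 2 0) ?(WN 0 1) ?(WN 1 2) ?E0 ?E1 ?E2;
      rewrite ?mulr0n ?mulr1n; ring.
  by exists g => j; rewrite -gE addrC subrK.
exists (\col_i g i); apply/colP => a.
rewrite mul_trA0_mx -[LHS](quo_ev_coord (fun a => v a 0)).
transitivity (\sum_i \sum_j ker_ev k a i j *: ('X_i * g j + t *+ (j == i))).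
  apply: eq_bigr => i _; apply: eq_bigr => j _.
  by rewrite -/(S j i) gE addrC [g j * _]mulrC.
under eq_bigr do under eq_bigr do rewrite scalerDr.
under eq_bigr do rewrite big_split.
rewrite big_split /= [X in _ + X](_ : _ = (\tr (ker_ev k a)) *: t).
  rewrite tr_ker_ev scale0r addr0.
  by apply: eq_bigr => i _; apply: eq_bigr => j _; rewrite mxE.
rewrite /mxtrace scaler_suml; apply: eq_bigr => i _.
under eq_bigr do rewrite -scalerMnr.
exact: (sum_delta (fun j => ker_ev k a i j *: t)).
Qed.

(** Here w is a symmetric matrix C with [X]_x C = 0. Its columns are multiples of X, and by symmetry
    C = c X X^T. *)
Lemma ker_trD0_mx (w : 'cV[R]_6) : D0_mx^T *m w = 0 -> exists c, w = f0_mx^T *m c.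
Proof.
move=> Dw; pose C i j : R := w (idx2 i j) 0.
have CC i j : C i j = C j i by rewrite /C idx2C.
have E i j : 'X_(j + 1) * C (j + 2) i - 'X_(j + 2) * C (j + 1) i = 0.
  move: i j; apply: (@quo_ev_orthogonal _ R
    (fun i j => 'X_(j + 1) * C (j + 2) i - 'X_(j + 2) * C (j + 1) i)).
    rewrite sum_ord3 !ord3D (CC 1 0) (CC 2 0) (CC 2 1); ring.
  by move=> a; rewrite -mul_trD0_mx Dw mxE.
have [s sE] : exists s, forall i j, C j i = 'X_j * s i.
  apply: (@ord3_choice R (fun i s => forall j, C j i = 'X_j * s)) => i.
  by apply: koszul2 => j; apply: subr0_eq.
have [|c cE] := @koszul2 _ s; first by move=> i; rewrite -!sE CC.
exists (c%:M); apply/colP => m; rewrite mul_mx_scalar !mxE.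
rewrite -[m in LHS]idx2_fst_snd -/(C _ _) sE cE mon2E mpolyXD; ring.
Qed.

(** Write q as X^T Q X with Q triangular. As Q X is orthogonal to X, it equals N X for an
    alternating N; the rows of Q - N are orthogonal to X, so Q - N = S [X]_x, and symmetrizing loses
    N. *)
Lemma ker_f0_mx (q : 'cV[R]_6) : f0_mx *m q = 0 -> exists v, q = D0_mx *m v.
Proof.
move=> fq; pose Q i j := \sum_m q m 0 *+ ((i == fst2 m) && (j == snd2 m)).
have sumQ (F : 'I_3 -> 'I_3 -> R) :
    \sum_i \sum_j Q i j * F i j = \sum_m q m 0 * F (fst2 m) (snd2 m).
  under eq_bigr do under eq_bigr do rewrite mulr_suml.
  under eq_bigr do rewrite exchange_big /=.
  rewrite exchange_big /=; apply: eq_bigr => m _.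
  rewrite (bigD1 (fst2 m)) //= (bigD1 (snd2 m)) //= !eqxx mulr1n.
  rewrite [X in _ + X + _]big1 => [|j /negPf jm]; last by rewrite jm andbF mul0r.
  rewrite addr0 [X in _ + X]big1 ?addr0 // => i /negPf im.
  by rewrite big1 // => j _; rewrite im mul0r.
have [|c cE] := @koszul1 _ (fun i => \sum_j Q i j * 'X_j).
  transitivity (\sum_i \sum_j Q i j * ('X_i * 'X_j)).
    apply: eq_bigr => i _; rewrite mulr_sumr; apply: eq_bigr => j _.
    by rewrite mulrCA.
  rewrite sumQ; transitivity ((f0_mx *m q) 0 0); [rewrite mxE | by rewrite fq mxE].
  by apply: eq_bigr => m _; rewrite mxE mon2E mpolyXD mulrC.
(* The alternating matrix for which N X is the cross product of X with c. *)
pose N i j := if j == i + 1 then c (i + 2) else if j == i + 2 then - c (i + 1) else 0.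
have [s sE] : exists s : 'I_3 -> 'I_3 -> R, forall i j, Q i j - N i j =
    'X_(j + 1) * s i (j + 2) - 'X_(j + 2) * s i (j + 1).
  apply: (@ord3_choice _ (fun i s => forall j, Q i j - N i j =
    'X_(j + 1) * s (j + 2) - 'X_(j + 2) * s (j + 1))) => i; apply: koszul1.
  transitivity (\sum_j Q i j * 'X_j - \sum_j N i j * 'X_j).
    by rewrite -sumrB; apply: eq_bigr => j _ /=; ring.
  rewrite cE /N sum_ord3; move: i; apply: ord3_ind; rewrite !ord3D !ord3_eq; ring.
pose S i j := - s i j.
have QN i j : Q i j = cross_mx S i j + N i j.
  by rewrite -[LHS](subrK (N i j)) sE /S /cross_mx; ring.
exists (\col_a \sum_i \sum_j ker_ev k a i j *: S j i).
apply/colP => m; rewrite mxE.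
under eq_bigr do rewrite !mxE mulrC.
rewrite (sum_ker_quo_ev (fun i j => S j i)); last first.
  rewrite sum_ord3 /D0_val !ord3D (idx2C 1 0) (idx2C 2 0) (idx2C 2 1); ring.
rewrite exchange_big /= D0_val_cross.
transitivity (\sum_i \sum_j (cross_mx S i j *+ (m == idx2 i j) + N i j *+ (m == idx2 i j))).
  transitivity (\sum_i \sum_j Q i j * (m == idx2 i j)%:R).
    rewrite sumQ; under eq_bigr do rewrite idx2_fst_snd mulr_natr.
    by rewrite sum_deltar.
  apply: eq_bigr => i _; apply: eq_bigr => j _.
  by rewrite -mulrnDl -QN mulr_natr.
under eq_bigr do rewrite big_split.
rewrite big_split /= (sum_idx2_alternating (F := N)) ?addr0 //.
  by move=> i; elim/ord3_ind: i; rewrite /N !ord3D !ord3_eq.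
by move=> i j; elim/ord3_ind: i; elim/ord3_ind: j; rewrite /N !ord3D !ord3_eq ?opprK ?oppr0.
Qed.

(** An off-diagonal matrix unit of ker(ev) produces an entry X_j w_i. The positions 2, 0, 1 in
    [ker_ev] hold the units (1, 0), (0, 1), (0, 2). *)
Lemma trA0_mx_inj (w : 'cV[R]_3) : A0_mx^T *m w = 0 -> w = 0.
Proof.
move=> Aw; apply/colP => i; rewrite mxE.
suff [j [c E]] : exists j c, 'X_j * w i 0 = (A0_mx^T *m w) c 0.
  by apply: (@mpolyX_inj _ _ j); rewrite E Aw mxE mulr0.
have K a : (A0_mx^T *m w) a 0 = \sum_i \sum_j ker_ev k a i j *: ('X_i * w j 0).
  exact: mul_trA0_mx.
move: i; apply: ord3_ind.
- exists 1, (inord 2); rewrite K !sum_ord3 /ker_ev (tnth_nth 0) inordK //= !mxE.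
  by rewrite !ord3_eq /= !scale0r scale1r !add0r !addr0.
- exists 0, (inord 0); rewrite K !sum_ord3 /ker_ev (tnth_nth 0) inordK //= !mxE.
  by rewrite !ord3_eq /= !scale0r scale1r !add0r !addr0.
- exists 0, (inord 1); rewrite K !sum_ord3 /ker_ev (tnth_nth 0) inordK //= !mxE.
  by rewrite !ord3_eq /= !scale0r scale1r !add0r !addr0.
Qed.

End SquareOfMaximalIdeal.

Lemma linear_lfunE (k : fieldType) (aT rT : vectType k) (f : aT -> rT) :
  linear f -> linfun f =1 f.
Proof.
move=> lf; pose F : {linear aT -> rT} := HB.pack f (GRing.isLinear.Build _ _ _ _ f lf).
exact: (lfunE F).
Qed.

(** * Linear forms as elements of the polynomial ring *)

Section LinearForms.

Variables (k : fieldType) (U : vectType k).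
Local Notation P := {mpoly k[\dim {: U}]}.

Lemma lin_is_linear : linear (@lin k U).
Proof.
move=> c u v; rewrite /lin scaler_sumr -big_split; apply: eq_bigr => i _ /=.
by rewrite linearP scalerDl scalerA.
Qed.

HB.instance Definition _ := GRing.isLinear.Build k U P _ (@lin k U) lin_is_linear.

Lemma lin_homog (u : U) : lin u \is 1.-homog.
Proof.
by rewrite /lin rpred_sum // => i _; rewrite rpredZ // dhomogX /= mdeg1.
Qed.

Lemma lin_inj (u : U) : lin u = 0 -> u = 0.
Proof.
move=> u0; rewrite [u](coord_vbasis (memvf u)) big1 // => i _.
suff -> : coord (vbasis {: U}) i u = (lin u)@_U_(i) by rewrite u0 mcoeff0 scale0r.
rewrite /lin raddf_sum (bigD1 i) //= mcoeffZ mcoeffXU eqxx mulr1 big1 ?addr0 //.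
by move=> j /negPf ij; rewrite mcoeffZ mcoeffXU ij mulr0.
Qed.

Lemma lin_vbasis (i : 'I_(\dim {: U})) : lin (vbasis {: U})`_i = 'X_i :> P.
Proof.
rewrite /lin (bigD1 i) //= coord_free ?(basis_free (vbasisP _)) // eqxx scale1r.
rewrite big1 ?addr0 // => j /negPf ji.
by rewrite coord_free ?(basis_free (vbasisP _)) // eq_sym ji scale0r.
Qed.

End LinearForms.

(** * The trilinear form of Phi, the map p and the product on U *)

Section CubicForm.

Variables (k : fieldType) (U : vectType k).
Local Notation P := {mpoly k[\dim {: U}]}.
Variables (Phi : {scalar P}) (x : U).

Lemma act_E (q : P) (t : U) : act Phi q t = Phi (q * lin t).
Proof.
rewrite linear_lfunE // => c u v.
by rewrite /contract !linearP /= mulrDr linearD -scalerAr linearZ.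
Qed.

Lemma p_map_E (u v : U) : p_map x Phi u v = Phi (lin x * lin u * lin v).
Proof.
have lin1 w : linear (fun t => contract (lin w) (contract (lin x) Phi) (lin t) : k^o).
  move=> c s t; rewrite /contract !linearP /= !mulrDr linearD.
  by rewrite -!scalerAr linearZ.
rewrite /p_map linear_lfunE => [|c s t].
  by rewrite linear_lfunE // /contract mulrA.
apply/lfunP => w; rewrite add_lfunE scale_lfunE !linear_lfunE //.
rewrite /contract linearP /= mulrDl mulrDr linearD.
by rewrite -scalerAl -scalerAr linearZ.
Qed.

(** The symmetric trilinear form of Phi, locked against unfolding; [tri Phi x] is the form b. *)
Definition tri (u v t : U) : k := locked (Phi (lin u * lin v * lin t)).

Lemma triE u v t : tri u v t = Phi (lin u * lin v * lin t).
Proof. by rewrite /tri -lock. Qed.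

Lemma triC u v t : tri u v t = tri v u t.
Proof. by rewrite !triE [lin u * _]mulrC. Qed.

Lemma triCA u v t : tri u v t = tri u t v.
Proof. by rewrite !triE mulrAC. Qed.

Lemma tri_linear u v : linear (tri u v : U -> k^o).
Proof.
by move=> c s t; rewrite !triE linearP /= mulrDr linearD -scalerAr linearZ.
Qed.

HB.instance Definition _ u v :=
  GRing.isLinear.Build k U k^o _ (tri u v : U -> k^o) (tri_linear u v).

Hypothesis p_inj : forall u : U, (forall t, tri x u t = 0) -> u = 0.

(** [p_inv] inverts [p_map] only on its image; injectivity and the equality of the dimensions of U
    and U^* make the image everything. *)
Lemma p_invE nu t : tri x (p_inv x Phi nu) t = nu t.
Proof.
have ker0 : lker (p_map x Phi) = 0%VS.
  apply/eqP/lker0P => u v /lfunP E; apply/eqP; rewrite -subr_eq0; apply/eqP.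
  by apply: p_inj => s; rewrite triE -p_map_E linearB /= add_lfunE opp_lfunE E subrr.
have full : limg (p_map x Phi) = fullv.
  apply/eqP; rewrite eqEdim subvf limg_dim_eq ?ker0 ?capv0 // !dimvf.
  by rewrite -[X in (_ <= X)%N]muln1 leqnn.
by rewrite triE -p_map_E limg_lfunVK // full memvf.
Qed.

Lemma nondeg u v : (forall t, tri x u t = tri x v t) -> u = v.
Proof.
move=> E; apply/eqP; rewrite -subr_eq0; apply/eqP/p_inj => t.
by rewrite triCA linearB /= ![tri x t _]triCA E subrr.
Qed.

(* The product of A = P / ann Phi transported along multiplication by x,
   from A_1 to A_2: it is commutative, not associative, with unit x. *)
Definition circ (u v : U) : U := locked (p_inv x Phi (act Phi (lin u * lin v))).

Lemma circ_def u v : p_inv x Phi (act Phi (lin u * lin v)) = circ u v.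
Proof. by rewrite /circ -lock. Qed.

Lemma circE u v t : tri x (circ u v) t = tri u v t.
Proof. by rewrite -circ_def p_invE act_E triE. Qed.

Lemma circC u v : circ u v = circ v u.
Proof. by rewrite -!circ_def mulrC. Qed.

Lemma circ1 u : circ u x = u.
Proof. by apply: nondeg => t; rewrite circE triC. Qed.

Lemma circ_is_linear u : linear (circ u).
Proof.
move=> c v w; apply: nondeg => t.
rewrite circE triCA linearP [tri x _ _]triCA linearP /=.
by rewrite ![tri _ t _]triCA !circE.
Qed.

Lemma circ_adj u v t : tri x (circ u v) t = tri x v (circ u t).
Proof. by rewrite circE triCA [RHS]triCA circE triCA. Qed.

End CubicForm.

(** * Coordinates with respect to x, y, z, w *)

Section Coordinates.

Variables (k : fieldType) (U : vectType k) (dimU : \dim {: U} = 4%N).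
Variables (x : U) (xs : 'Hom(U, k^o)) (xs_x : xs x = 1) (y z w : U).
Hypothesis basis_yzw : basis_of (lker xs) [:: y; z; w].
Local Notation u_ := (basU0 y z w).
Local Notation nu_ := (dualU0 x y z w).

Lemma basU0E : ((u_ 0 = y) * (u_ 1 = z) * (u_ 2 = w))%type.
Proof. by rewrite /basU0 !(tnth_nth 0). Qed.

Lemma xs_basU0 i : xs (u_ i) = 0.
Proof.
apply/eqP; rewrite -memv_ker; apply: (basis_mem basis_yzw).
by rewrite /basU0 mem_tnth.
Qed.

Lemma basis_xyzw : basis_of {: U} [:: x; y; z; w].
Proof.
rewrite basisEfree subvf dimU leqnn andbT free_cons (basis_free basis_yzw) andbT.
by rewrite (span_basis basis_yzw) memv_ker xs_x oner_eq0.
Qed.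

Lemma dualU0E i u : nu_ i u = coord [tuple x; y; z; w] (lift ord0 i) u.
Proof. by rewrite linear_lfunE // => c s t; rewrite linearP. Qed.

Lemma dualU0_basU0 i j : nu_ i (u_ j) = (i == j)%:R.
Proof.
rewrite dualU0E; have -> : u_ j = [tuple x; y; z; w]`_(lift ord0 j).
  by rewrite /basU0 (tnth_nth 0).
by rewrite coord_free ?(basis_free basis_xyzw) // (inj_eq lift_inj) eq_sym.
Qed.

Lemma dualU0_x i : nu_ i x = 0.
Proof.
rewrite dualU0E -[x in coord _ _ x]/([tuple x; y; z; w]`_(ord0 : 'I_4)).
by rewrite coord_free ?(basis_free basis_xyzw).
Qed.

Lemma decomp u : u = (xs u : k) *: x + \sum_i (nu_ i u : k) *: u_ i.
Proof.
have E := coord_basis (X := [tuple x; y; z; w]) basis_xyzw (memvf u).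
rewrite big_ord_recl in E; rewrite {1}E /=.
have uE : \sum_(i < 3) coord [tuple x; y; z; w] (lift ord0 i) u *: [:: y; z; w]`_i
         = \sum_i (nu_ i u : k) *: u_ i.
  by apply: eq_bigr => i _; rewrite dualU0E /basU0 (tnth_nth 0).
rewrite uE; congr (_ *: _ + _).
have := congr1 xs E; rewrite linearD linearZ /= xs_x uE linear_sum big1 ?addr0.
  by rewrite [_ *: 1]mulr1 => ->.
by move=> i _; rewrite linearZ /= xs_basU0 scaler0.
Qed.

Lemma projU0_is_linear : linear (projU0 x y z w).
Proof.
move=> c u v; rewrite /projU0 scaler_sumr -big_split /=; apply: eq_bigr => i _.
by rewrite linearP scalerDl scalerA.
Qed.

HB.instance Definition _ :=
  GRing.isLinear.Build k U {mpoly k[3]} _ (projU0 x y z w) projU0_is_linear.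

Lemma projU0_x : projU0 x y z w x = 0.
Proof. by rewrite /projU0 big1 // => i _; rewrite dualU0_x scale0r. Qed.

Lemma projU0_basU0 i : projU0 x y z w (u_ i) = 'X_i.
Proof.
rewrite /projU0 (bigD1 i) //= dualU0_basU0 eqxx scale1r big1 ?addr0 // => j.
by move/negPf => ji; rewrite dualU0_basU0 ji scale0r.
Qed.

Lemma inclU0_is_linear : linear (inclU0 y z w).
Proof. by move=> c p q; rewrite /inclU0 linearP. Qed.

Lemma inclU0_proj u : inclU0 y z w (projU0 x y z w u) = lin u - (xs u : k) *: lin x.
Proof.
transitivity (lin ((xs u : k) *: x + \sum_i (nu_ i u : k) *: u_ i) - (xs u : k) *: lin x).
  rewrite linearD linearZ /= addrC addKr /inclU0 /projU0 !linear_sum /=.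
  apply: eq_bigr => i _.
  by rewrite !linearZ /= comp_mpolyXU -tnth_nth tnth_mktuple.
by rewrite -decomp.
Qed.

End Coordinates.

Lemma mdeg2_mon2 (m : 'X_{1..3}) : mdeg m = 2 -> exists n, m = mon2 n.
Proof.
move=> m2; have [i mi] : exists i, m i != 0%N.
  apply/existsP; apply: contraT; rewrite negb_exists => /forallP m0.
  by move: m2; rewrite mdegE big1 // => i _; have := m0 i; rewrite negbK => /eqP.
have lei : (U_(i) <= m)%MM by rewrite lep1mP.
have : mdeg (m - U_(i))%MM == 1%N.
  by rewrite -(eqn_add2r (mdeg U_(i)%MM)) -mdegD submK // m2 mdeg1.
rewrite mdeg_eq1 => /existsP[j /eqP Ej]; exists (idx2 j i).
by rewrite mon2_idx2 -Ej submK.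
Qed.

Lemma homog2_mon2 (k : fieldType) (q : {mpoly k[3]}) : q \is 2.-homog ->
  q = \sum_m q@_(mon2 m) *: 'X_[mon2 m].
Proof.
move=> hq; apply/mpolyP => n; rewrite raddf_sum /=.
have [/eqP /mdeg2_mon2[m ->]|n2] := boolP (mdeg n == 2).
  rewrite (bigD1 m) //= mcoeffZ mcoeffX eqxx mulr1 big1 ?addr0 // => m' /negPf mm'.
  by rewrite mcoeffZ mcoeffX (inj_eq mon2_inj) mm' mulr0.
rewrite (dhomog_nemf_coeff hq n2) big1 // => m _.
rewrite mcoeffZ mcoeffX; case: eqP => [E|_]; last by rewrite mulr0.
by move: n2; rewrite -E mon2E mdegD !mdeg1.
Qed.

(* V stands for U with the product mul = circ and the form b(u, v) = Phi(x u v),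
   for which x is a unit and multiplications are self-adjoint; sh_ i is p^-1 of
   u_i^*, e is p^-1 of x^* and kap m s t is the m-th coordinate of proj(s) proj(t).
   Then brak l is the commutator of the multiplications by u_(l + 1) and
   u_(l + 2), and B maps s (x) u_l^* to b(brak l s, -).  The values of A, B, C, D
   on u_i (x) u_j^* have coordinates A_ent i j, B_ent i j, C_ent i j, D_ent i j. *)
Section CommutativeFrobenius.

Variables (k : fieldType) (V : lmodType k) (S : comNzRingType).
Variables (c : {rmorphism k -> S}) (lin : {additive V -> S}).
Variables (mul : V -> {linear V -> V}) (b : V -> {linear V -> k^o}).
Variables (kap : 'I_6 -> V -> {linear V -> k^o}).
Variables (x e : V) (u_ sh_ : 'I_3 -> V) (nu_ : 'I_3 -> {linear V -> k^o}).

Hypothesis linZ : forall a v, lin (a *: v) = c a * lin v.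
Hypothesis mulC : forall s t, mul s t = mul t s.
Hypothesis mulx : forall s, mul s x = s.
Hypothesis bC : forall s t, b s t = b t s.
Hypothesis b_adj : forall s t r, b (mul s t) r = b t (mul s r).
Hypothesis b_nondeg : forall s t, (forall r, b s r = b t r) -> s = t.
Hypothesis b_sh : forall i t, b (sh_ i) t = nu_ i t.
Hypothesis decomp : forall v, v = (b e v : k) *: x + \sum_i (nu_ i v : k) *: u_ i.
Hypothesis nu_u : forall i j, nu_ i (u_ j) = (i == j)%:R.
Hypothesis kapC : forall m s t, kap m s t = kap m t s.
Hypothesis kap_x : forall m s, kap m s x = 0.

Local Notation X := (lin x).

Definition brak (l : 'I_3) (s : V) : V :=
  mul (u_ (l + 1)) (mul (u_ (l + 2)) s) - mul (u_ (l + 2)) (mul (u_ (l + 1)) s).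

Lemma mul_subx s t a d :
  mul (s - a *: x) (t - d *: x) = mul s t - d *: s - a *: t + (a * d) *: x.
Proof.
have mulB r u v f : mul r (u - f *: v) = mul r u - f *: mul r v.
  by rewrite linearB linearZ.
rewrite mulB !(mulC (s - _)) !mulB !mulx (mulC x s) mulx (mulC t s).
rewrite scalerBr scalerA [d * a]mulrC opprB addrA.
by rewrite [_ - d *: s - a *: t]addrAC [RHS]addrAC.
Qed.

Lemma brak_x l : brak l x = 0.
Proof. by rewrite /brak !mulx mulC subrr. Qed.

(** A commutator of self-adjoint operators is skew-adjoint. *)
Lemma brak_skew l s t : b (brak l s) t = - b s (brak l t).
Proof.
rewrite /brak bC linearB /= ![b t _]bC linearB /= opprB.
by rewrite !b_adj.
Qed.

(** Commutators kill the unit x, and skewness moves them onto x. This is why the values of B lie in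
    U_0^*. *)
Lemma brak_perp l s : b (brak l s) x = 0.
Proof. by rewrite brak_skew brak_x linear0 oppr0. Qed.

(** The vectors e, sh_i form the basis dual to x, u_i for b. *)
Lemma dual_decomp v : v = (b v x : k) *: e + \sum_i (b v (u_ i) : k) *: sh_ i.
Proof.
apply: b_nondeg => t; rewrite [RHS]bC linearD linearZ linear_sum /=.
rewrite {1}[t]decomp linearD linearZ linear_sum /=; congr (_ + _).
  by rewrite [b t e]bC; apply: mulrC.
apply: eq_bigr => i _; rewrite !linearZ /= [b t _]bC b_sh; exact: mulrC.
Qed.

Definition A_ent (i j p : 'I_3) : S :=
  (j == p)%:R * lin (u_ i) - c (nu_ j (mul (u_ i) (u_ p))) * X.

Definition B_ent (i j q : 'I_3) : k := b (brak j (u_ i)) (u_ q).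

Definition C_ent (i j : 'I_3) (m : 'I_6) : k := - kap m (u_ i) (sh_ j).

(** D on s (x) u_l^* with s allowed in all of V, since products of elements of U_0 leave U_0. It
    vanishes at s = x, so only the projection of s to U_0 counts. *)
Definition D_fun (l : 'I_3) (s : V) (m : 'I_6) : S :=
  c (kap m (u_ (l + 1)) (mul (u_ (l + 2)) s)) * X
  - c (kap m (u_ (l + 2)) (mul (u_ (l + 1)) s)) * X
  + c (kap m (u_ (l + 2)) s) * lin (u_ (l + 1))
  - c (kap m (u_ (l + 1)) s) * lin (u_ (l + 2)).

Definition D_ent (i j : 'I_3) (m : 'I_6) : S := D_fun j (u_ i) m.

Lemma D_funD l m s t : D_fun l (s + t) m = D_fun l s m + D_fun l t m.
Proof. by rewrite /D_fun !linearD /= !rmorphD /=; ring. Qed.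

Lemma D_funZ l m a s : D_fun l (a *: s) m = c a * D_fun l s m.
Proof. by rewrite /D_fun !linearZ /= !rmorphM /=; ring. Qed.

Lemma D_fun_x l m : D_fun l x m = 0.
Proof. by rewrite /D_fun !mulx !kap_x kapC rmorph0; ring. Qed.

Lemma D_fun_proj l m v : D_fun l v m = \sum_i c (nu_ i v) * D_fun l (u_ i) m.
Proof.
have D0 : D_fun l 0 m = 0 by rewrite -[0](scale0r 0) D_funZ rmorph0 mul0r.
rewrite {1}[v]decomp D_funD D_funZ D_fun_x mulr0 add0r.
rewrite (big_morph (fun s => D_fun l s m) (D_funD l m) D0).
by apply: eq_bigr => i _; rewrite D_funZ.
Qed.

(** B is well defined modulo ev^*(1): the product being commutative, the six terms cancel in pairs.
    The same holds for D. *)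
Lemma B_ent_trace q : \sum_i B_ent i i q = 0.
Proof.
rewrite sum_ord3 /B_ent /brak !ord3D ![b _ (u_ q)]bC !linearB /=.
by rewrite (mulC (u_ 2) (u_ 0)) (mulC (u_ 1) (u_ 0)) (mulC (u_ 2) (u_ 1)); ring.
Qed.

Lemma D_ent_trace m : \sum_i D_ent i i m = 0.
Proof.
rewrite sum_ord3 /D_ent /D_fun !ord3D.
rewrite (mulC (u_ 2) (u_ 0)) (mulC (u_ 1) (u_ 0)) (mulC (u_ 2) (u_ 1)).
rewrite (kapC m (u_ 2) (u_ 0)) (kapC m (u_ 1) (u_ 0)) (kapC m (u_ 2) (u_ 1)); ring.
Qed.

(** The coordinates in the x-part of A reassemble the product of u_i and u_p; its component along x
    is lost without harm, because commutators kill x. *)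
Lemma sum_A_B p q : \sum_i \sum_j A_ent i j p * c (B_ent j i q) =
  \sum_i (c (b (brak i (u_ p)) (u_ q)) * lin (u_ i)
           - c (b (brak i (mul (u_ i) (u_ p))) (u_ q)) * X).
Proof.
apply: eq_bigr => i _; rewrite /A_ent /B_ent.
under eq_bigr do rewrite mulrBl.
rewrite sumrB (bigD1 p) //= eqxx mul1r [X in _ + X - _]big1 ?addr0; last first.
  by move=> j /negPf jp; rewrite jp !mul0r.
rewrite [c _ * _]mulrC; congr (_ - _).
rewrite [mul (u_ i) (u_ p) in RHS]decomp.
have bb s t : b (brak i s) t = - b (brak i t) s by rewrite brak_skew bC.
rewrite [in RHS]bb linearD linear_sum linearZ /= -/(brak i (u_ q)).
rewrite brak_perp scaler0 add0r -sumrN rmorph_sum mulr_suml.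
apply: eq_bigr => j _; rewrite linearZ /= bb -mulrN rmorphM /=; ring.
Qed.

(** The coefficients of lin (u_ i) cancel by skewness. In the X-part, exchanging p and q transposes
    an operator, so the sum is that of the commutators of brak i with multiplication by u_i. *)
Lemma A_B_skew p q : \sum_i \sum_j A_ent i j p * c (B_ent j i q) +
  \sum_i \sum_j A_ent i j q * c (B_ent j i p) = 0.
Proof.
rewrite !sum_A_B !sum_ord3.
have skew i : b (brak i (u_ q)) (u_ p) = - b (brak i (u_ p)) (u_ q).
  by rewrite brak_skew bC.
rewrite !skew.
have G i s t : b (brak i s) t =
    b (mul (u_ (i + 2)) s) (mul (u_ (i + 1)) t) - b (mul (u_ (i + 1)) s) (mul (u_ (i + 2)) t).
  by rewrite /brak bC linearB /= ![b t _]bC !b_adj.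
rewrite !G !ord3D.
have H i j l : b (mul (u_ i) (mul (u_ j) (u_ q))) (mul (u_ l) (u_ p)) =
  b (mul (u_ i) (mul (u_ l) (u_ p))) (mul (u_ j) (u_ q)) by rewrite bC -b_adj.
rewrite !H !rmorphB !rmorphN /= !rmorphB /=; ring.
Qed.

(** Summing B against C over the dual bases leaves the kap m (u_ i) (brak i (u_ p)). Their terms
    also occur, cyclically relabelled and with opposite sign, in the X^2-part of the first sum. *)
Lemma A_D_C p m : \sum_i \sum_j A_ent i j p * D_ent j i m +
  X ^+ 2 * \sum_i \sum_j c (B_ent j i p * C_ent i j m) = 0.
Proof.
have -> : \sum_i \sum_j A_ent i j p * D_ent j i m =
    \sum_i (lin (u_ i) * D_fun i (u_ p) m - X * D_fun i (mul (u_ i) (u_ p)) m).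
  apply: eq_bigr => i _; rewrite /A_ent /D_ent.
  under eq_bigr do rewrite mulrBl.
  rewrite sumrB (bigD1 p) //= eqxx mul1r [X in _ + X - _]big1 ?addr0; last first.
    by move=> j /negPf jp; rewrite jp !mul0r.
  congr (_ - _); rewrite [in RHS]D_fun_proj mulr_sumr.
  by apply: eq_bigr => j _; ring.
have -> : \sum_i \sum_j c (B_ent j i p * C_ent i j m) =
    \sum_i c (kap m (u_ i) (brak i (u_ p))).
  apply: eq_bigr => i _; rewrite -rmorph_sum; congr (c _).
  rewrite [brak i (u_ p)]dual_decomp brak_perp scale0r add0r linear_sum.
  apply: eq_bigr => j _; rewrite linearZ /= /B_ent /C_ent.
  by rewrite brak_skew bC mulrNN.
rewrite !sum_ord3 /D_fun /brak !ord3D !linearB /= !rmorphB /=; ring.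
Qed.

(* The tensor \sum_j sh_ j (x) u_ j + e (x) x is symmetric and commutes with
   self-adjoint operators. *)
Lemma casimir_adj m m' s t r :
  \sum_j kap m s (sh_ j) * kap m' t (mul r (u_ j)) + kap m s e * kap m' t (mul r x) =
  \sum_j kap m' t (sh_ j) * kap m s (mul r (u_ j)) + kap m' t e * kap m s (mul r x).
Proof.
have E n q v : kap n q v = b v x * kap n q e + \sum_i b v (u_ i) * kap n q (sh_ i).
  rewrite {1}[v]dual_decomp linearD linearZ linear_sum; congr (_ + _).
  by apply: eq_bigr => i _; rewrite linearZ.
rewrite !sum_ord3 !(E _ _ (mul r _)) !sum_ord3.
have sym q v : b (mul r q) v = b (mul r v) q by rewrite b_adj bC.
rewrite (sym x (u_ 0)) (sym x (u_ 1)) (sym x (u_ 2)).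
rewrite (sym (u_ 0) (u_ 1)) (sym (u_ 0) (u_ 2)) (sym (u_ 1) (u_ 2)); ring.
Qed.

Lemma C_D_skew m m' : \sum_i \sum_j c (C_ent i j m) * D_ent j i m' +
  \sum_i \sum_j c (C_ent i j m') * D_ent j i m = 0.
Proof.
(* h contracts C with one term of D, and [hE] exchanges the monomials n and n'. The correction comes
   from the summand e (x) x in [casimir_adj]; it cancels in the cyclic sums by the symmetry of
   [kap]. *)
pose h n n' i l r := \sum_j kap n (u_ i) (sh_ j) * kap n' (u_ l) (mul r (u_ j)).
have hE n n' i l r : h n n' i l r = h n' n l i r +
    kap n' (u_ l) e * kap n (u_ i) r - kap n (u_ i) e * kap n' (u_ l) r.
  have := casimir_adj n n' (u_ i) (u_ l) r; rewrite !mulx -/(h n n' i l r).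
  by move=> E; apply: (addIr (kap n (u_ i) e * kap n' (u_ l) r)); rewrite E /h; ring.
have CD n n' : \sum_i \sum_j c (C_ent i j n) * D_ent j i n' = - \sum_i
    ((c (h n n' i (i + 1) (u_ (i + 2))) - c (h n n' i (i + 2) (u_ (i + 1)))) * X
     + c (h n n' i (i + 2) x) * lin (u_ (i + 1))
     - c (h n n' i (i + 1) x) * lin (u_ (i + 2))).
  rewrite -sumrN; apply: eq_bigr => i _; rewrite /h !rmorph_sum -sumrB !mulr_suml.
  rewrite -big_split -sumrB -sumrN; apply: eq_bigr => j _.
  rewrite /C_ent /D_ent /D_fun ![mul x _]mulC !mulx !rmorphM !rmorphN /=; ring.
rewrite !CD !sum_ord3 !ord3D.
rewrite (hE m' m 0 1 (u_ 2)) (hE m' m 1 2 (u_ 0)) (hE m' m 2 0 (u_ 1)).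
rewrite (hE m' m 0 2 (u_ 1)) (hE m' m 1 0 (u_ 2)) (hE m' m 2 1 (u_ 0)).
rewrite (hE m' m 0 1 x) (hE m' m 1 2 x) (hE m' m 2 0 x).
rewrite (hE m' m 0 2 x) (hE m' m 1 0 x) (hE m' m 2 1 x).
rewrite !kap_x ?(kapC m (u_ 1) (u_ 0)) ?(kapC m (u_ 2) (u_ 0)) ?(kapC m (u_ 2) (u_ 1)).
rewrite ?(kapC m' (u_ 1) (u_ 0)) ?(kapC m' (u_ 2) (u_ 0)) ?(kapC m' (u_ 2) (u_ 1)).
rewrite !rmorphB !rmorphD !rmorphM /=; ring.
Qed.

Let wedge_nu l i j : V := (nu_ l (u_ i) : k) *: u_ j - (nu_ l (u_ j) : k) *: u_ i.

(** For u_l^* only two of the three wedges are nonzero, namely u_(l+1) and u_(l+2) up to sign; this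
    makes the formulas for B and D cyclic. *)
Lemma B_ent_wedge i l q :
  - b (mul (u_ 0) (mul (wedge_nu l 1 2) (u_ i))) (u_ q)
  + b (mul (u_ 1) (mul (wedge_nu l 0 2) (u_ i))) (u_ q)
  - b (mul (u_ 2) (mul (wedge_nu l 0 1) (u_ i))) (u_ q) = B_ent i l q.
Proof.
have W r l' i' j' : b (mul r (mul (wedge_nu l' i' j') (u_ i))) (u_ q) =
    (nu_ l' (u_ i') : k) * b (mul r (mul (u_ j') (u_ i))) (u_ q)
    - (nu_ l' (u_ j') : k) * b (mul r (mul (u_ i') (u_ i))) (u_ q).
  by rewrite !(mulC _ (u_ i)) ![b _ (u_ q)]bC /wedge_nu !linearB !linearZ.
rewrite !W !nu_u /B_ent /brak ![b _ (u_ q)]bC linearB /=.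
elim/ord3_ind: l; rewrite !ord3D !ord3_eq /=; ring.
Qed.

Lemma D_ent_wedge i l m :
  - (c (kap m (u_ 2) (mul (wedge_nu l 0 1) (u_ i))) * X)
  + c (kap m (u_ 1) (mul (wedge_nu l 0 2) (u_ i))) * X
  - c (kap m (u_ 0) (mul (wedge_nu l 1 2) (u_ i))) * X
  - c (kap m (wedge_nu l 0 1) (u_ i)) * lin (u_ 2)
  + c (kap m (wedge_nu l 0 2) (u_ i)) * lin (u_ 1)
  - c (kap m (wedge_nu l 1 2) (u_ i)) * lin (u_ 0) = D_ent i l m.
Proof.
have W1 l' i' j' : kap m (wedge_nu l' i' j') (u_ i) =
    (nu_ l' (u_ i') : k) * kap m (u_ j') (u_ i)
    - (nu_ l' (u_ j') : k) * kap m (u_ i') (u_ i).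
  by rewrite !(kapC _ _ (u_ i)) /wedge_nu linearB !linearZ.
have W2 r l' i' j' : kap m r (mul (wedge_nu l' i' j') (u_ i)) =
    (nu_ l' (u_ i') : k) * kap m r (mul (u_ j') (u_ i))
    - (nu_ l' (u_ j') : k) * kap m r (mul (u_ i') (u_ i)).
  by rewrite !(mulC _ (u_ i)) /wedge_nu !linearB !linearZ.
rewrite !W1 !W2 !nu_u /D_ent /D_fun.
elim/ord3_ind: l; rewrite !ord3D !ord3_eq /=; ring.
Qed.

(** * Products of the generators with A, B, C, D *)

Section Generators.

Variable f12_ : 'I_6 -> S.
Hypothesis f12_kap : forall s t,
  \sum_m f12_ m * c (kap m s t) = lin s * lin t - X * lin (mul s t).

(** The term with e is proportional to the trace and disappears on ker(ev). The rest, times X,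
    cancels X^2 times the value in [f12_C]. *)
Lemma f11_A i j : \sum_p X * lin (sh_ p) * A_ent i j p =
  X * (lin (u_ i) * lin (sh_ j) - X * lin (mul (u_ i) (sh_ j)) + (i == j)%:R * X * lin e).
Proof.
rewrite /A_ent; under eq_bigr do rewrite mulrBr.
rewrite sumrB (bigD1 j) //= eqxx [X in _ + X - _]big1 ?addr0; last first.
  by move=> p /negPf jp; rewrite eq_sym jp !(mul0r, mulr0).
rewrite (_ : mul (u_ i) (sh_ j) =
    ((i == j)%:R : k) *: e + \sum_p (nu_ j (mul (u_ i) (u_ p)) : k) *: sh_ p).
  rewrite raddfD (raddf_sum lin) /= linZ rmorph_nat.
  under [in RHS]eq_bigr do rewrite linZ.
  transitivity (X * (lin (u_ i) * lin (sh_ j) -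
      X * \sum_p c (nu_ j (mul (u_ i) (u_ p))) * lin (sh_ p))); last by ring.
  rewrite mulrBr !mulr_sumr; congr (_ - _); first by ring.
  by apply: eq_bigr => p _; ring.
rewrite [LHS]dual_decomp; congr (_ *: _ + _).
  by rewrite b_adj mulx b_sh nu_u eq_sym.
by apply: eq_bigr => p _; rewrite b_adj b_sh.
Qed.

Lemma f12_C i j : \sum_m f12_ m * c (C_ent i j m) =
  X * lin (mul (u_ i) (sh_ j)) - lin (u_ i) * lin (sh_ j).
Proof.
under eq_bigr do rewrite /C_ent rmorphN mulrN.
by rewrite sumrN f12_kap opprB.
Qed.

Lemma f12_D i j : \sum_m f12_ m * D_ent i j m = - X ^+ 2 * lin (brak j (u_ i)).
Proof.
transitivity (\sum_m
    (f12_ m * c (kap m (u_ (j + 1)) (mul (u_ (j + 2)) (u_ i))) * X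
     - f12_ m * c (kap m (u_ (j + 2)) (mul (u_ (j + 1)) (u_ i))) * X
     + f12_ m * c (kap m (u_ (j + 2)) (u_ i)) * lin (u_ (j + 1))
     - f12_ m * c (kap m (u_ (j + 1)) (u_ i)) * lin (u_ (j + 2)))).
  by apply: eq_bigr => m _; rewrite /D_ent /D_fun; ring.
rewrite sumrB big_split sumrB /= -!mulr_suml !f12_kap /brak raddfB /=; ring.
Qed.

Lemma f11_B i j : \sum_p X * lin (sh_ p) * c (B_ent i j p) = X * lin (brak j (u_ i)).
Proof.
rewrite {1}[brak j (u_ i)]dual_decomp brak_perp scale0r add0r raddf_sum mulr_sumr.
by apply: eq_bigr => p _; rewrite linZ /B_ent; ring.
Qed.

End Generators.

End CommutativeFrobenius.

(** * Entries of matrix products *)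

Section Entrywise.

Lemma sum6_mxE (V : zmodType) (n : nat) (t1 t2 t3 t4 t5 t6 : 'cV[V]_n) i :
  (- t1 + t2 - t3 - t4 + t5 - t6) i 0 =
  - t1 i 0 + t2 i 0 - t3 i 0 - t4 i 0 + t5 i 0 - t6 i 0.
Proof. by rewrite !mxE. Qed.

Lemma sum3_lfunE (k : fieldType) (U V : vectType k) (f g h : 'Hom(U, V)) u :
  (- f + g - h) u = - f u + g u - h u.
Proof. by rewrite !add_lfunE !opp_lfunE. Qed.

Lemma tensSym2E (k : fieldType) (U : vectType k) (f : {mpoly k[\dim {: U}]}) q m :
  tensSym2 f q m 0 = (q@_(mon2 m))%:MP * f.
Proof. by rewrite mxE mul_mpolyC. Qed.

Lemma mul_ker_quo (k : fieldType) (n r s : nat)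
    (M : 'M[{mpoly k[n]}]_(r, 8)) (N : 'M[{mpoly k[n]}]_(s, 8)) f g :
    (forall p a, M p a = \sum_i \sum_j ker_ev k a i j *: f i j p) ->
    (forall q a, N q a = \sum_i \sum_j quo_ev k a i j *: g i j q) ->
    (forall q, \sum_i g i i q = 0) ->
  forall p q, (M *m N^T) p q = \sum_i \sum_j f i j p * g j i q.
Proof.
move=> ME NE g0 p q; rewrite mxE.
under eq_bigr => a _ do rewrite ME [N^T a q]mxE NE.
exact: (sum_ker_quo_ev (fun i j => f i j p) (g0 q)).
Qed.

Lemma mul_ev_mx (k : fieldType) (n r s : nat) (K : 'I_8 -> 'M[k]_3)
    (M : 'M[{mpoly k[n]}]_(r, s)) (N : 'M[{mpoly k[n]}]_(s, 8)) f i a :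
    (forall p a, N p a = \sum_i \sum_j K a i j *: f i j p) ->
  (M *m N) i a = \sum_j \sum_l K a j l *: (\sum_p M i p * f j l p).
Proof.
move=> NE; rewrite mxE; under eq_bigr do rewrite NE mulr_sumr.
rewrite exchange_big /=; apply: eq_bigr => j _.
under eq_bigr do rewrite mulr_sumr.
rewrite exchange_big /=; apply: eq_bigr => l _.
by rewrite scaler_sumr; apply: eq_bigr => p _; rewrite scalerAr.
Qed.

Lemma mulmx_trC (R : comNzRingType) (m n r : nat) (M : 'M[R]_(m, n)) (N : 'M_(r, n)) :
  N *m M^T = (M *m N^T)^T.
Proof. by rewrite trmx_mul trmxK. Qed.

Lemma addmxE (V : nmodType) (m n : nat) (M N : 'M[V]_(m, n)) i j :
  (M + N) i j = M i j + N i j.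
Proof. by rewrite mxE. Qed.

Lemma scalemxE (R : pzRingType) (m n : nat) a (M : 'M[R]_(m, n)) i j :
  (a *: M) i j = a * M i j.
Proof. by rewrite mxE. Qed.

Lemma trmxE (T : Type) (m n : nat) (M : 'M[T]_(m, n)) i j : M^T i j = M j i.
Proof. by rewrite mxE. Qed.

Lemma trmxZ (R : pzRingType) (m n : nat) a (M : 'M[R]_(m, n)) : (a *: M)^T = a *: M^T.
Proof. exact: linearZ. Qed.

End Entrywise.

(** * The differentials form a complex *)

Section Complex.

Variables (k : fieldType) (U : vectType k) (dimU : \dim {: U} = 4%N).
Local Notation P := {mpoly k[\dim {: U}]}.
Variables (Phi : {scalar P}) (x : U) (xs : 'Hom(U, k^o)) (xs_x : xs x = 1).
Variables (y z w : U).
Hypothesis basis_yzw : basis_of (lker xs) [:: y; z; w].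
Hypothesis p_inj : forall u : U, (forall t, tri Phi x u t = 0) -> u = 0.

Local Notation X := (lin x : P).
Local Notation u_ := (basU0 y z w).
Local Notation nu_ := (dualU0 x y z w).
Local Notation sharp nu := (p_inv x Phi nu).
Local Notation proj := (projU0 x y z w).

Let mul (s : U) : {linear U -> U} :=
  HB.pack (circ Phi x s) (GRing.isLinear.Build _ _ _ _ _ (circ_is_linear p_inj s)).
Let b (s : U) : {linear U -> k^o} := tri Phi x s.
Let nu (i : 'I_3) : {linear U -> k^o} := fun_of_lfun (nu_ i).
Let e : U := sharp xs.
Let sh (i : 'I_3) : U := sharp (nu_ i).
Let c : {rmorphism k -> P} := @mpolyC (\dim {: U}) k.
Let linP : {additive U -> P} := @lin k U.

Lemma kap_is_linear m s : linear (fun t => (proj s * proj t)@_(mon2 m) : k^o).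
Proof. by move=> a u v; rewrite linearP /= mulrDr mcoeffD -scalerAr mcoeffZ. Qed.

Let kap (m : 'I_6) (s : U) : {linear U -> k^o} :=
  HB.pack (fun t => (proj s * proj t)@_(mon2 m) : k^o)
    (GRing.isLinear.Build _ _ _ _ _ (kap_is_linear m s)).

Let linZ a v : linP (a *: v) = c a * linP v.
Proof. by rewrite /= linearZ mul_mpolyC. Qed.
Let mulC s t : mul s t = mul t s. Proof. exact: circC. Qed.
Let mulx s : mul s x = s. Proof. exact: (circ1 p_inj). Qed.
Let bC s t : b s t = b t s. Proof. exact: (triCA Phi x s t). Qed.
Let b_adj s t r : b (mul s t) r = b t (mul s r). Proof. exact: (circ_adj p_inj). Qed.
Let b_nondeg s t : (forall r, b s r = b t r) -> s = t. Proof. exact: (nondeg p_inj). Qed.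
Let b_sh i t : b (sh i) t = nu i t. Proof. exact: (p_invE p_inj). Qed.
Let nu_u i j : nu i (u_ j) = (i == j)%:R.
Proof. exact: (dualU0_basU0 dimU xs_x basis_yzw). Qed.
Let kapC m s t : kap m s t = kap m t s. Proof. by rewrite /= mulrC. Qed.
Let kap_x m s : kap m s x = 0.
Proof. by rewrite /= (projU0_x dimU xs_x basis_yzw) mulr0 mcoeff0. Qed.
Let b_e t : b t e = xs t. Proof. by rewrite bC; exact: (p_invE p_inj). Qed.
Let decompU v : v = (b e v : k) *: x + \sum_i (nu i v : k) *: u_ i.
Proof. by rewrite bC b_e; exact: (decomp dimU xs_x basis_yzw). Qed.

Lemma kap_basU0 m i j : kap m (u_ i) (u_ j) = (m == idx2 i j)%:R.
Proof.
by rewrite /= !(projU0_basU0 dimU xs_x basis_yzw) -mpolyXD mcoeffX eq_mon2.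
Qed.

Let A := A_ent c linP mul x u_ nu.
Let B := B_ent mul b u_.
Let C := C_ent kap u_ sh.
Let D := D_ent c linP mul kap x u_.

Let circ_mul (s t : U) : sharp (act Phi (lin s * lin t)) = mul s t.
Proof. exact: circ_def. Qed.

Let act_mul s t r v : act Phi (lin s * lin (sharp (act Phi (lin t * lin r)))) v =
  tri Phi x (circ Phi x s (circ Phi x t r)) v.
Proof. by rewrite circ_def act_E -triE -(circE p_inj). Qed.

Lemma C_valE i j m : C_val x y z w Phi (u_ i) (nu_ j) m 0 = C i j m.
Proof. by rewrite /C_val mxE mcoeffN. Qed.

Lemma A_valE i j p : A_val x y z w Phi (u_ i) (nu_ j) p 0 = A i j p.
Proof.
rewrite /A_val /tensU0dual !mxE act_E -triE triCA -(circE p_inj) triCA p_invE //.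
rewrite addrC [nu_ j (u_ p)]nu_u -!mul_mpolyC rmorph_nat.
by rewrite /A /A_ent.
Qed.

Let yE : y = u_ 0. Proof. by rewrite basU0E. Qed.
Let zE : z = u_ 1. Proof. by rewrite basU0E. Qed.
Let wE : w = u_ 2. Proof. by rewrite basU0E. Qed.

Lemma B_valE i j q : B_val x y z w Phi (u_ i) (nu_ j) q 0 = B i j q.
Proof.
rewrite /B_val mxE /B_fun sum3_lfunE.
transitivity (- tri Phi x (circ Phi x y (circ Phi x (wedge (nu_ j) z w) (u_ i))) (u_ q)
  + tri Phi x (circ Phi x z (circ Phi x (wedge (nu_ j) y w) (u_ i))) (u_ q)
  - tri Phi x (circ Phi x w (circ Phi x (wedge (nu_ j) y z) (u_ i))) (u_ q)).
  by congr (- _ + _ - _); exact: act_mul.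
move: (B_ent_wedge mulC bC nu_u i j q).
by rewrite /wedge -yE -zE -wE.
Qed.

Lemma D_valE i j m : D_val x y z w Phi (u_ i) (nu_ j) m 0 = D i j m.
Proof.
rewrite /D_val [LHS]sum6_mxE 6!tensSym2E.
rewrite (circ_mul (wedge (nu_ j) y z) (u_ i)) (circ_mul (wedge (nu_ j) y w) (u_ i)).
rewrite (circ_mul (wedge (nu_ j) z w) (u_ i)).
move: (D_ent_wedge c linP x mulC nu_u kapC i j m).
by rewrite /wedge -yE -zE -wE.
Qed.

Lemma A_mxE p a : A_mx x y z w Phi p a =
  \sum_j \sum_l ker_ev k a j l *: A j l p.
Proof.
rewrite mxE; apply: eq_bigr => j _; apply: eq_bigr => l _.
by rewrite A_valE.
Qed.

Lemma B_mxE q a : (B_mx x y z w Phi q a)%:MP_[\dim {: U}] =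
  \sum_j \sum_l quo_ev k a j l *: (B j l q)%:MP.
Proof.
rewrite mxE rmorph_sum; apply: eq_bigr => j _.
rewrite rmorph_sum; apply: eq_bigr => l _.
by rewrite B_valE rmorphM /= mul_mpolyC.
Qed.

Lemma C_mxE m a : (C_mx x y z w Phi m a)%:MP_[\dim {: U}] =
  \sum_j \sum_l ker_ev k a j l *: (C j l m)%:MP.
Proof.
rewrite mxE rmorph_sum; apply: eq_bigr => j _.
rewrite rmorph_sum; apply: eq_bigr => l _.
by rewrite C_valE rmorphM /= mul_mpolyC.
Qed.

Lemma D_mxE m a : D_mx x y z w Phi m a =
  \sum_j \sum_l quo_ev k a j l *: D j l m.
Proof.
rewrite mxE; apply: eq_bigr => j _; apply: eq_bigr => l _.
by rewrite D_valE.
Qed.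

Local Notation toP := (map_mx (@mpolyC (\dim {: U}) k)).
Local Notation Amx := (A_mx x y z w Phi).
Local Notation Bmx := (toP (B_mx x y z w Phi)).
Local Notation Cmx := (toP (C_mx x y z w Phi)).
Local Notation Dmx := (D_mx x y z w Phi).

Let B_ent0 q : \sum_i (B i i q)%:MP_[\dim {: U}] = 0.
Proof. by rewrite -rmorph_sum B_ent_trace ?rmorph0. Qed.

Let D_ent0 m : \sum_i D i i m = 0.
Proof. exact: D_ent_trace. Qed.

Let BmxE q a : Bmx q a = \sum_i \sum_j quo_ev k a i j *: (B i j q)%:MP.
Proof. by rewrite mxE B_mxE. Qed.

Let CmxE m a : Cmx m a = \sum_i \sum_j ker_ev k a i j *: (C i j m)%:MP.
Proof. by rewrite mxE C_mxE. Qed.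

Lemma A_trB p q : (Amx *m Bmx^T) p q = \sum_i \sum_j A i j p * (B j i q)%:MP.
Proof. exact: (mul_ker_quo A_mxE BmxE B_ent0). Qed.

Lemma A_trD p m : (Amx *m Dmx^T) p m = \sum_i \sum_j A i j p * D j i m.
Proof. exact: (mul_ker_quo A_mxE D_mxE D_ent0). Qed.

Lemma C_trB m q : (Cmx *m Bmx^T) m q = \sum_i \sum_j (C i j m)%:MP * (B j i q)%:MP.
Proof. exact: (mul_ker_quo CmxE BmxE B_ent0). Qed.

Lemma C_trD m m' : (Cmx *m Dmx^T) m m' = \sum_i \sum_j (C i j m)%:MP * D j i m'.
Proof. exact: (mul_ker_quo CmxE D_mxE D_ent0). Qed.

Lemma A_trB_skew : Amx *m Bmx^T + Bmx *m Amx^T = 0.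
Proof.
apply/matrixP => p q; rewrite [Bmx *m _]mulmx_trC addmxE trmxE !A_trB [RHS]mxE.
by apply: (A_B_skew c linP) => //; exact: decompU.
Qed.

Lemma A_trD_B_trC : Amx *m Dmx^T + X ^+ 2 *: (Bmx *m Cmx^T) = 0.
Proof.
apply/matrixP => p m; rewrite [Bmx *m _]mulmx_trC addmxE scalemxE trmxE A_trD C_trB [RHS]mxE.
rewrite -[RHS](A_D_C c linP mulC mulx bC b_adj b_nondeg b_sh decompU kapC kap_x p m).
congr (_ + _ * _); apply: eq_bigr => i _; apply: eq_bigr => j _.
by rewrite -mpolyCM mulrC.
Qed.

Lemma C_trD_skew : Cmx *m Dmx^T + Dmx *m Cmx^T = 0.
Proof.
apply/matrixP => m m'; rewrite [Dmx *m _]mulmx_trC addmxE trmxE !C_trD [RHS]mxE.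
by apply: (C_D_skew c linP) => //; exact: decompU.
Qed.

Lemma act_linear : linear (act Phi).
Proof.
move=> a q r; apply/lfunP => t; rewrite add_lfunE scale_lfunE !act_E.
by rewrite mulrDl -scalerAl linearD linearZ.
Qed.

Lemma f12_linear : linear (f12 x y z w Phi).
Proof.
move=> a q r; rewrite /f12 (inclU0_is_linear y z w) act_linear linearP linearP /=.
rewrite mulrDr -scalerAr scalerBr; ring.
Qed.

(** Subtracting multiples of x from s and t changes both terms on the right equally, because x is
    the unit. So s and t need not lie in U_0. *)
Lemma f12_proj s t :
  f12 x y z w Phi (proj s * proj t) = lin s * lin t - X * lin (circ Phi x s t).
Proof.
rewrite /f12 /inclU0 rmorphM /= -/(inclU0 y z w (proj s)) -/(inclU0 y z w (proj t)).
rewrite !(inclU0_proj dimU xs_x basis_yzw).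
have linB u : lin u - (xs u : k) *: X = lin (u - (xs u : k) *: x).
  by rewrite addrC -!scaleNr [in RHS]addrC lin_is_linear.
rewrite !linB circ_def.
have mulE : circ Phi x (s - (xs s : k) *: x) (t - (xs t : k) *: x) =
    mul s t - (xs t : k) *: s - (xs s : k) *: t + ((xs s : k) * (xs t : k)) *: x.
  exact: (mul_subx mulC mulx).
rewrite mulE /=.
have linDZ u v a : lin (u + a *: v) = lin u + a%:MP * lin v :> P.
  by rewrite addrC lin_is_linear mul_mpolyC addrC.
have linBZ u v a : lin (u - a *: v) = lin u - a%:MP * lin v :> P.
  by rewrite -scaleNr linDZ mpolyCN mulNr.
rewrite linDZ !linBZ mpolyCM; ring.
Qed.

Lemma f12_mx_kap s t :
  \sum_m f12 x y z w Phi 'X_[mon2 m] * (kap m s t)%:MP =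
  lin s * lin t - X * lin (circ Phi x s t).
Proof.
rewrite -f12_proj.
have hq : proj s * proj t \is 2.-homog.
  rewrite (dhomogM (d := 1) (e := 1)) // /projU0 rpred_sum // => i _;
  by rewrite rpredZ // dhomogX /= mdeg1.
rewrite [proj s * _](homog2_mon2 hq).
pose f12l : {linear {mpoly k[3]} -> P} := HB.pack (f12 x y z w Phi)
  (GRing.isLinear.Build _ _ _ _ _ f12_linear).
rewrite -[f12 _ _ _ _ _ _]/(f12l _) linear_sum; apply: eq_bigr => m _.
by rewrite linearZ /= mulrC mul_mpolyC.
Qed.

Let f12_ m := f12 x y z w Phi 'X_[mon2 m].

Local Notation f11mx := (f11_mx x y z w Phi).
Local Notation f12mx := (f12_mx x y z w Phi).

Lemma f11_mx_A a : (f11mx *m Amx) 0 a = \sum_j \sum_l ker_ev k a j l *: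
  (X * (lin (u_ j) * lin (sh l) - X * lin (mul (u_ j) (sh l)) + (j == l)%:R * X * lin e)).
Proof.
rewrite (mul_ev_mx _ _ _ A_mxE); apply: eq_bigr => j _; apply: eq_bigr => l _.
congr (_ *: _); under eq_bigr do rewrite mxE.
rewrite /f11; exact: (f11_A linZ mulx bC b_adj b_nondeg b_sh decompU nu_u).
Qed.

Lemma f12_mx_C a : (f12mx *m Cmx) 0 a = \sum_j \sum_l ker_ev k a j l *:
  (X * lin (mul (u_ j) (sh l)) - lin (u_ j) * lin (sh l)).
Proof.
rewrite (mul_ev_mx _ _ _ CmxE); apply: eq_bigr => j _; apply: eq_bigr => l _.
congr (_ *: _); under eq_bigr do rewrite mxE.
exact: (f12_C (c := c) (lin := linP) (mul := mul) (kap := kap) (x := x)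
  u_ sh (f12_ := f12_) f12_mx_kap j l).
Qed.

Lemma f11_mx_B a : (f11mx *m Bmx) 0 a = \sum_j \sum_l quo_ev k a j l *:
  (X * lin (brak mul u_ l (u_ j))).
Proof.
rewrite (mul_ev_mx _ _ _ BmxE); apply: eq_bigr => j _; apply: eq_bigr => l _.
congr (_ *: _); under eq_bigr do rewrite mxE.
rewrite /f11; exact: (f11_B linZ mulC mulx bC b_adj b_nondeg b_sh decompU).
Qed.

Lemma f12_mx_D a : (f12mx *m Dmx) 0 a = \sum_j \sum_l quo_ev k a j l *:
  (- X ^+ 2 * lin (brak mul u_ l (u_ j))).
Proof.
rewrite (mul_ev_mx _ _ _ D_mxE); apply: eq_bigr => j _; apply: eq_bigr => l _.
congr (_ *: _); under eq_bigr do rewrite mxE.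
exact: (f12_D (c := c) (lin := linP) (mul := mul) (kap := kap) (x := x)
  u_ (f12_ := f12_) f12_mx_kap j l).
Qed.

Local Notation d1 := (d1_mx x y z w Phi).
Local Notation d2 := (d2_mx x y z w Phi).
Local Notation d3 := (d3_mx x y z w Phi).
Local Notation d4 := (d4_mx x y z w Phi).

Lemma d1_d2 : d1 *m d2 = 0.
Proof.
rewrite /d1_mx /d2_mx mul_row_block -(row_mx0 _ 1 8 8); congr row_mx.
  apply/matrixP => i a; rewrite ord1 addmxE -scalemxAl -scalemxAr !scalemxE.
  rewrite f11_mx_A f12_mx_C [RHS]mxE !mulr_sumr -big_split /=.
  (* Off the diagonal everything cancels; the diagonal leaves the trace of an element of ker(ev). *)
  transitivity ((\tr (ker_ev k a))%:MP * (X ^+ 3 * lin e)); last first.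
    by rewrite tr_ker_ev mpolyC0 mul0r.
  rewrite /mxtrace rmorph_sum mulr_suml; apply: eq_bigr => j _.
  rewrite 2!mulr_sumr -big_split (bigD1 j) //= [X in _ + X]big1 ?addr0; last first.
    move=> l /negPf lj; rewrite eq_sym lj -!scalerAr -scalerDr.
    by set t := _ + _; rewrite (_ : t = 0) ?scaler0 // /t /=; ring.
  by rewrite eqxx -!scalerAr -!mul_mpolyC /=; ring.
apply/matrixP => i a; rewrite ord1 addmxE -scalemxAl scalemxE f11_mx_B f12_mx_D [RHS]mxE.
rewrite mulr_sumr -big_split big1 //= => j _.
rewrite mulr_sumr -big_split big1 //= => l _.
by rewrite -scalerAr -scalerDr; set t := _ + _; rewrite (_ : t = 0) ?scaler0 // /t; ring.
Qed.

(** d_3 is the transpose of d_2 with its block rows exchanged. Hence the lower left block of the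
    product is the transpose of the upper right one, and three identities suffice. *)
Lemma d2_d3 : d2 *m d3 = 0.
Proof.
rewrite /d2_mx /d3_mx mulmx_block.
rewrite A_trB_skew -!scalemxAr -!scalemxAl A_trD_B_trC.
have CB : X ^+ 2 *: (Cmx *m Bmx^T) + Dmx *m Amx^T = 0.
  rewrite -[LHS]trmxK raddfD /= linearZ /= !trmx_mul !trmxK addrC.
  by rewrite A_trD_B_trC trmx0.
by rewrite CB -scalerDr C_trD_skew scaler0 block_mx_const.
Qed.

Lemma d3_d4 : d3 *m d4 = 0.
Proof.
have := congr1 trmx d1_d2; rewrite trmx0 trmx_mul /d1_mx /d2_mx.
rewrite tr_row_mx tr_block_mx mul_block_col -[0](col_mx0 _ 8 8 1).
move=> /eq_col_mx[E1 E2]; rewrite /d3_mx /d4_mx mul_block_col; congr col_mx.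
  by rewrite -trmxZ.
by rewrite -!trmxZ.
Qed.

(** Isolates the dependence on Phi in a multiple of X, for the reduction modulo x. *)
Lemma A_mx_modx p a : exists g : k, Amx p a =
  \sum_i \sum_j ker_ev k a i j *: ((j == p)%:R * lin (u_ i)) + X * g%:MP.
Proof.
exists (- \sum_i \sum_j ker_ev k a i j * nu j (mul (u_ i) (u_ p))).
rewrite A_mxE mpolyCN mulrN rmorph_sum mulr_sumr -sumrB; apply: eq_bigr => i _.
rewrite rmorph_sum mulr_sumr -sumrB; apply: eq_bigr => j _.
rewrite scalerBr; congr (_ - _).
by rewrite -mul_mpolyC mulrA -mpolyCM mulrC.
Qed.

Lemma D_mx_modx m a : exists g : k, Dmx m a =
  \sum_i \sum_j quo_ev k a i j *:
    (lin (u_ (j + 1)) * (m == idx2 (j + 2) i)%:R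
     - lin (u_ (j + 2)) * (m == idx2 (j + 1) i)%:R) + X * g%:MP.
Proof.
exists (\sum_i \sum_j quo_ev k a i j * (kap m (u_ (j + 1)) (mul (u_ (j + 2)) (u_ i))
   - kap m (u_ (j + 2)) (mul (u_ (j + 1)) (u_ i)))).
rewrite D_mxE rmorph_sum mulr_sumr -big_split; apply: eq_bigr => i _.
rewrite rmorph_sum mulr_sumr -big_split; apply: eq_bigr => j _.
rewrite /= rmorphM [X * _]mulrCA [_%:MP * (X * _)]mul_mpolyC -scalerDr.
congr (_ *: _); rewrite /D /D_ent /D_fun !kap_basU0 /= mpolyCB.
by rewrite !rmorph_nat; ring.
Qed.

Lemma f12_mon2 m : f12 x y z w Phi 'X_[mon2 m] =
  lin (u_ (fst2 m)) * lin (u_ (snd2 m)) - X * lin (circ Phi x (u_ (fst2 m)) (u_ (snd2 m))).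
Proof.
by rewrite -f12_proj !(projU0_basU0 dimU xs_x basis_yzw) -mpolyXD -mon2E.
Qed.

Lemma sharp_decomp v : v = (tri Phi x v x : k) *: sharp xs
  + \sum_i (tri Phi x v (u_ i) : k) *: sharp (nu_ i).
Proof. exact: (dual_decomp bC b_nondeg b_sh decompU). Qed.

End Complex.

(** * The cokernel of A_0 *)

Section CokernelA0.

Variable k : fieldType.
Local Notation R := {mpoly k[3]}.

Lemma A0_mx_image (S : 'I_3 -> 'I_3 -> R) : \sum_i S i i = 0 ->
  exists v : 'cV[R]_8, forall p, (A0_mx k *m v) p 0 = \sum_i 'X_i * S i p.
Proof.
move=> S0; exists (\col_a \sum_i \sum_j quo_ev k a i j *: S j i) => p.
rewrite mul_A0_mx; apply: eq_bigr => i _; congr (_ * _).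
pose e l h : R := ((l == i) && (h == p))%:R.
transitivity (\sum_l \sum_h e l h * S l h).
  rewrite -(@sum_ker_quo_ev _ _ e (fun i j => S j i)) //; apply: eq_bigr => a _.
  have -> : \sum_l \sum_h ker_ev k a l h *: e l h = (ker_ev k a i p)%:MP.
    rewrite (bigD1 i) //= (bigD1 p) //= /e !eqxx /= [X in _ *: _ + X + _]big1; last first.
      by move=> h /negPf hp; rewrite hp scaler0.
    rewrite [X in _ + X]big1 ?addr0; last first.
      by move=> l /negPf li; rewrite big1 // => h _; rewrite li scaler0.
    by rewrite -mul_mpolyC mulr1.
  by rewrite mxE mul_mpolyC.
rewrite (bigD1 i) //= (bigD1 p) //= /e !eqxx mul1r [X in _ + X + _]big1; last first.
  by move=> h /negPf hp; rewrite hp andbF mul0r.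
rewrite [X in _ + X]big1 ?addr0 // => l /negPf li.
by rewrite big1 // => h _; rewrite li mul0r.
Qed.

(* The cokernel of A0_mx is spanned by the classes of the basis vectors and of
   'X_0 times the first of them. *)
Definition coker_rep (r : 'cV[R]_3) := exists (v : 'cV[R]_8) (a : k) (a0 : 'I_3 -> k),
  r = A0_mx k *m v + \col_p ((p == 0)%:R * a%:MP * 'X_0 + (a0 p)%:MP).

Lemma coker_repD r s : coker_rep r -> coker_rep s -> coker_rep (r + s).
Proof.
move=> [v [a [a0 ->]]] [v' [a' [a0' ->]]].
exists (v + v'), (a + a'), (fun p => a0 p + a0' p).
rewrite mulmxDr addrACA; congr (_ + _); apply/colP => p; rewrite !mxE.
rewrite !mpolyCD; ring.
Qed.

Lemma coker_rep_image S (r : 'cV[R]_3) : \sum_i S i i = 0 ->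
  (forall p, r p 0 = \sum_i 'X_i * S i p) -> coker_rep r.
Proof.
move=> /A0_mx_image[v vE] rE; exists v, 0, (fun=> 0); apply/colP => p.
by rewrite mxE vE -rE !mxE mpolyC0 mulr0 mul0r !addr0.
Qed.

Lemma coker_repZ (a : k) r : coker_rep r -> coker_rep (a%:MP *: r).
Proof.
move=> [v [c [a0 ->]]]; exists (a%:MP *: v), (a * c), (fun p => a * a0 p).
rewrite scalerDr -scalemxAr; congr (_ + _); apply/colP => p; rewrite !mxE.
rewrite !mpolyCM; ring.
Qed.

Let basis_vec (f : R) (p : 'I_3) : 'cV[R]_3 := \col_q ((q == p)%:R * f).

(** The matrix unit at (i, p) with i != p is traceless, as is the difference of two diagonal units;
    so all X_i e_i have the same class and the other X_i e_p are in the image. *)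
Lemma coker_rep_X (i p : 'I_3) : coker_rep (basis_vec 'X_i p).
Proof.
have imX (j q : 'I_3) : j != q -> coker_rep (basis_vec 'X_j q).
  move=> /negPf jq.
  apply: (@coker_rep_image (fun l h => ((l == j) && (h == q))%:R)) => [|h].
    by rewrite big1 // => l _; case: eqP => // ->; rewrite jq.
  rewrite mxE (bigD1 j) //= eqxx big1 ?addr0 => [|l /negPf ->]; last by rewrite mulr0.
  by rewrite mulrC.
have X0 : coker_rep (basis_vec 'X_0 0).
  exists 0, 1, (fun=> 0); rewrite mulmx0 add0r; apply/colP => q.
  by rewrite !mxE mpolyC0 mpolyC1 mulr1 addr0.
have [<-|] := eqVneq i p; last exact: imX.
have -> : basis_vec 'X_i i = (basis_vec 'X_i i - basis_vec 'X_0 0) + basis_vec 'X_0 0.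
  by rewrite subrK.
apply: coker_repD => //.
apply: (@coker_rep_image (fun l h => ((l == i) && (h == i))%:R
  - ((l == 0) && (h == 0))%:R)) => [|h].
  rewrite sumrB (bigD1 i) // [X in _ - X](bigD1 0) //= !eqxx !big1 ?addr0 ?subrr //.
    by move=> l /negPf ->.
  by move=> l /negPf ->.
rewrite !mxE; under eq_bigr do rewrite mulrBr.
rewrite sumrB (bigD1 i) // [X in _ = _ - X](bigD1 0) //= !eqxx !big1 /=.
- by rewrite !addr0 ![_ * 'X_ _]mulrC.
- by move=> l /negPf ->; rewrite mulr0.
- by move=> l /negPf ->; rewrite mulr0.
Qed.

Lemma coker_rep_mulX (i : 'I_3) r : coker_rep r -> coker_rep ('X_i *: r).
Proof.
move=> [v [a [a0 rE]]].
have -> : 'X_i *: r = A0_mx k *m ('X_i *: v) +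
    (a%:MP *: basis_vec ('X_i * 'X_0) 0 + \sum_p (a0 p)%:MP *: basis_vec 'X_i p).
  rewrite rE scalerDr -scalemxAr; congr (_ + _); apply/colP => q.
  rewrite !mxE summxE; under eq_bigr do rewrite !mxE.
  rewrite (bigD1 q) //= eqxx big1 ?addr0 => [|p /negPf pq]; last first.
    by rewrite eq_sym pq mul0r mulr0.
  by rewrite /=; ring.
apply: coker_repD.
  exists ('X_i *: v), 0, (fun=> 0); apply/colP => q.
  by rewrite !mxE mpolyC0 mulr0 mul0r !addr0.
apply: coker_repD; last first.
  apply: (big_ind coker_rep) => [| |p _]; [|exact: coker_repD|]; last first.
    exact/coker_repZ/coker_rep_X.
  exists 0, 0, (fun=> 0); rewrite mulmx0; apply/colP => q.
  by rewrite !mxE mpolyC0 mulr0 mul0r !addr0.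
apply: coker_repZ.
have [->|/negPf i0] := eqVneq i 0; last first.
  apply: (@coker_rep_image (fun l h => ((l == i) && (h == 0))%:R * 'X_0)) => [|h].
    by rewrite big1 // => l _; case: eqP => [->|]; rewrite ?i0 mul0r.
  rewrite mxE (bigD1 i) //= eqxx big1 ?addr0 /= => [|l /negPf ->]; last first.
    by rewrite mul0r mulr0.
  by ring.
(* X_0^2 e_0 is in the image: the traceless diagonal (X_0, -X_0, 0) gives X_0^2 e_0 - X_0 X_1 e_1,
   and the entry X_1 at (0, 1) removes the second term. *)
apply: (@coker_rep_image (fun l h => if l == h then
   (if l == 0 then 'X_0 else if l == 1 then - 'X_0 else 0)
   else if (l == 0) && (h == 1) then 'X_1 else 0)).
  by rewrite sum_ord3 ?ord3_eq /=; ring.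
by apply: ord3_ind; rewrite mxE sum_ord3 ?ord3_eq /=; ring.
Qed.

Lemma coker_repP (r : 'cV[R]_3) : coker_rep r.
Proof.
have -> : r = \sum_p basis_vec (r p 0) p.
  apply/colP => q; rewrite summxE (bigD1 q) //= mxE eqxx mul1r big1 ?addr0 //.
  by move=> p /negPf pq; rewrite mxE eq_sym pq mul0r.
have z : coker_rep 0.
  exists 0, 0, (fun=> 0); rewrite mulmx0; apply/colP => q.
  by rewrite !mxE mpolyC0 mulr0 mul0r !addr0.
apply: (big_ind coker_rep) => // [|p _]; first exact: coker_repD.
elim/mpoly_ind_mulX: (r p 0) => [c|f g Lf Lg|f i Lf].
- exists 0, 0, (fun q => (q == p)%:R * c); rewrite mulmx0; apply/colP => q.
  by rewrite !mxE mpolyC0 mulr0 mul0r !add0r mpolyCM rmorph_nat.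
- have -> : basis_vec (f + g) p = basis_vec f p + basis_vec g p.
    by apply/colP => q; rewrite !mxE mulrDr.
  exact: coker_repD.
- have -> : basis_vec ('X_i * f) p = 'X_i *: basis_vec f p.
    by apply/colP => q; rewrite !mxE mulrCA.
  exact: coker_rep_mulX.
Qed.

End CokernelA0.

Lemma comp_mpoly_tuple (k : fieldType) (n r : nat) (F : 'I_n -> {mpoly k[r]}) i :
  'X_i \mPo [tuple F j | j < n] = F i.
Proof. by rewrite comp_mpolyXU -tnth_nth tnth_mktuple. Qed.

Lemma shiftsl m n a b (i : 'I_m) : @shifts m n a b (lshift n i) = a.
Proof. by rewrite /shifts /= ltn_ord. Qed.

Lemma shiftsr m n a b (i : 'I_n) : @shifts m n a b (rshift m i) = b.
Proof. by rewrite /shifts /= ltnNge leq_addr. Qed.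

Lemma lin_surj (k : fieldType) (U : vectType k) (f : {mpoly k[\dim {: U}]}) :
  f \is 1.-homog -> exists t : U, f = lin t.
Proof.
move=> hf; exists (\sum_i f@_U_(i) *: (vbasis {: U})`_i).
rewrite linear_sum; apply/mpolyP => m; rewrite raddf_sum /=.
under eq_bigr do rewrite linearZ /= lin_vbasis mcoeffZ mcoeffX.
have [/mdeg1P[i /eqP ->]|m1] := boolP (mdeg m == 1%N).
  rewrite (bigD1 i) //= eqxx mulr1 big1 ?addr0 // => j ji.
  case: eqP => [|_]; last by rewrite mulr0.
  by move=> /mnmP/(_ j); rewrite !mnm1E eqxx eq_sym (negPf ji).
rewrite (dhomog_nemf_coeff hf m1) big1 // => i _; case: eqP => [E|]; last by rewrite mulr0.
by move: m1; rewrite -E mdeg1.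
Qed.

(** * Reduction modulo x and exactness *)

Section Exactness.

Variables (k : fieldType) (U : vectType k) (dimU : \dim {: U} = 4%N).
Local Notation P := {mpoly k[\dim {: U}]}.
Local Notation R := {mpoly k[3]}.
Variables (Phi : {scalar P}) (x : U) (xs : 'Hom(U, k^o)) (xs_x : xs x = 1).
Variables (y z w : U).
Hypothesis basis_yzw : basis_of (lker xs) [:: y; z; w].
Hypothesis p_inj : forall u : U, (forall t, tri Phi x u t = 0) -> u = 0.
Hypothesis Phi_D3 : in_D 3 Phi.

Local Notation X := (lin x : P).
Local Notation u_ := (basU0 y z w).
Local Notation nu_ := (dualU0 x y z w).
Local Notation sharp nu := (p_inv x Phi nu).
Local Notation proj := (projU0 x y z w).
Local Notation incl := (inclU0 y z w).
Local Notation toP := (map_mx (@mpolyC (\dim {: U}) k)).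
Local Notation Amx := (A_mx x y z w Phi).
Local Notation Bmx := (toP (B_mx x y z w Phi)).
Local Notation Cmx := (toP (C_mx x y z w Phi)).
Local Notation Dmx := (D_mx x y z w Phi).
Local Notation f11mx := (f11_mx x y z w Phi).
Local Notation f12mx := (f12_mx x y z w Phi).
Local Notation d1 := (d1_mx x y z w Phi).
Local Notation d2 := (d2_mx x y z w Phi).
Local Notation d3 := (d3_mx x y z w Phi).
Local Notation d4 := (d4_mx x y z w Phi).

Let x_neq0 : X != 0.
Proof.
apply/eqP => /lin_inj x0; move: xs_x; rewrite x0 linear0 => /eqP.
by rewrite eq_sym oner_eq0.
Qed.

Local Notation redx :=
  (comp_mpoly [tuple proj (vbasis {: U})`_i | i < \dim {: U}]).

Let redx_lin u : redx (lin u) = proj u.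
Proof.
rewrite /lin linear_sum {2}[u](coord_vbasis (memvf u)) linear_sum.
by apply: eq_bigr => i _; rewrite !linearZ /= comp_mpoly_tuple.
Qed.

Let redx_x : redx X = 0.
Proof. by rewrite redx_lin (projU0_x dimU xs_x basis_yzw). Qed.

Let redx_u i : redx (lin (u_ i)) = 'X_i.
Proof. by rewrite redx_lin (projU0_basU0 dimU xs_x basis_yzw). Qed.

Let redx_incl q : redx (incl q) = q.
Proof.
elim/mpoly_ind_mulX: q => [c|p q IHp IHq|p i IHp].
- by rewrite /inclU0 !comp_mpolyC.
- by rewrite /inclU0 !comp_mpolyD; congr (_ + _).
- rewrite /inclU0 !rmorphM /= comp_mpoly_tuple redx_u.
  by congr (_ * _).
Qed.

Let inclD p q : incl (p + q) = incl p + incl q.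
Proof. exact: comp_mpolyD. Qed.

Let inclM p q : incl (p * q) = incl p * incl q.
Proof. exact: rmorphM. Qed.

(** The kernel of [redx] is generated by X, with [incl] as a section. *)
Let incl_redx f : exists g, f = incl (redx f) + X * g.
Proof.
elim/mpoly_ind_mulX: f => [c|p q [p' IHp] [q' IHq]|p i [p' IHp]].
- by exists 0; rewrite /inclU0 !comp_mpolyC mulr0 addr0.
- exists (p' + q'); rewrite [redx _]comp_mpolyD inclD mulrDr addrACA.
  by congr (_ + _).
- have Xi : 'X_i = incl (redx 'X_i) + X * (xs (vbasis {: U})`_i : k)%:MP :> P.
    rewrite -lin_vbasis redx_lin (inclU0_proj dimU xs_x basis_yzw).
    by rewrite mulrC mul_mpolyC subrK.
  have E (a a0 b b0 g h : P) : a = a0 + X * g -> b = b0 + X * h ->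
      a * b = a0 * b0 + X * (g * b0 + a0 * h + g * X * h) by move=> -> ->; ring.
  by rewrite rmorphM inclM /=; eexists; exact: E Xi IHp.
Qed.

Let redx_eq n (v v' : 'cV[P]_n) : map_mx redx v = map_mx redx v' ->
  exists s, v = v' + X *: s.
Proof.
move=> E; have [s sE] : exists s : 'I_n -> P, forall i, v i 0 - v' i 0 = X * s i.
  apply: (@fin_all_exists _ _ (fun i s => v i 0 - v' i 0 = X * s)) => i.
  have [g gE] := incl_redx (v i 0 - v' i 0); exists g; rewrite {1}gE.
  have /colP/(_ i) := E; rewrite !mxE rmorphB /= => ->.
  by rewrite subrr /inclU0 comp_mpoly0 add0r.
exists (\col_i s i); apply/colP => i.
by rewrite !mxE -sE addrC subrK.
Qed.

Let redx_surj n (v : 'cV[R]_n) : exists v', v = map_mx redx v'.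
Proof.
by exists (\col_i incl (v i 0)); apply/colP => i; rewrite !mxE redx_incl.
Qed.

Local Notation B0 := (map_mx (@mpolyC 3 k) (B_mx x y z w Phi)).

Let redx_A : map_mx redx Amx = A0_mx k.
Proof.
apply/matrixP => p a; rewrite mxE.
have [g ->] := A_mx_modx dimU xs_x basis_yzw p_inj p a.
rewrite rmorphD rmorphM /= redx_x mul0r addr0 linear_sum [RHS]mxE.
apply: eq_bigr => i _; rewrite linear_sum; apply: eq_bigr => j _.
by rewrite linearZ /= rmorphM /= rmorph_nat redx_u.
Qed.

Let redx_D : map_mx redx Dmx = D0_mx k.
Proof.
apply/matrixP => m a; rewrite mxE.
have [g ->] := D_mx_modx dimU xs_x basis_yzw p_inj m a.
rewrite rmorphD rmorphM /= redx_x mul0r addr0 linear_sum [RHS]mxE.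
apply: eq_bigr => i _; rewrite linear_sum; apply: eq_bigr => j _.
by rewrite linearZ /= rmorphB !rmorphM /= !rmorph_nat !redx_u.
Qed.

Let redx_toP m n (M : 'M[k]_(m, n)) : map_mx redx (toP M) = map_mx (@mpolyC 3 k) M.
Proof. by apply/matrixP => i j; rewrite !mxE comp_mpolyC. Qed.

Let redx_f12 : map_mx redx f12mx = f0_mx k.
Proof.
apply/matrixP => i m; rewrite !mxE (f12_mon2 dimU xs_x basis_yzw p_inj).
rewrite rmorphB !rmorphM /= redx_x mul0r subr0 !redx_u mon2E mpolyXD //.
Qed.

Let redx_d1 : map_mx redx d1 = row_mx 0 (f0_mx k).
Proof.
rewrite /d1_mx map_row_mx redx_f12 map_mxZ; congr row_mx.
by apply/matrixP => i j; rewrite !mxE /= redx_x mul0r.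
Qed.

Let redx_d2 : map_mx redx d2 = block_mx (A0_mx k) B0 0 (D0_mx k).
Proof.
rewrite /d2_mx map_block_mx redx_A redx_D redx_toP; congr block_mx.
by apply/matrixP => i j; rewrite !mxE rmorphM rmorphXn /= redx_x expr0n mul0r.
Qed.

Let redx_d3 : map_mx redx d3 = block_mx B0^T (D0_mx k)^T (A0_mx k)^T 0.
Proof.
rewrite /d3_mx map_block_mx -!map_trmx redx_A redx_D redx_toP; congr block_mx.
by apply/matrixP => i j; rewrite !mxE rmorphM rmorphXn /= redx_x expr0n mul0r.
Qed.

Let redx_d4 : map_mx redx d4 = col_mx 0 (f0_mx k)^T.
Proof.
rewrite /d4_mx map_col_mx -!map_trmx redx_f12; congr col_mx.
by apply/matrixP => i j; rewrite !mxE rmorphM /= redx_x mul0r.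
Qed.

Let A0_trB0 : A0_mx k *m B0^T + B0 *m (A0_mx k)^T = 0.
Proof.
have := congr1 (map_mx redx) (A_trB_skew dimU xs_x basis_yzw p_inj).
by rewrite map_mxD !map_mxM -!map_trmx redx_A redx_toP map_mx0.
Qed.

(** Modulo x, the lower part of a cycle is A_0^T ga by exactness of the dual complex. Subtracting
    B^T ga from the upper part leaves a cycle for A_0, because A_0 B^T = - B A_0^T. *)
Let step2 (v : 'cV[P]_(8 + 8)) : d2 *m v = 0 ->
  exists u v', v = d3 *m u + X *: v'.
Proof.
move=> /(congr1 (map_mx redx)); rewrite map_mxM redx_d2 map_mx0.
rewrite -[map_mx redx v]vsubmxK mul_block_col mul0mx add0r -(col_mx0 _ 3 6 1).
set al := usubmx _; set be := dsubmx _ => /eq_col_mx[E1 E2].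
have [ga gaE] := ker_D0_mx E2.
have [|de deE] := @ker_A0_mx _ (al - B0^T *m ga).
  rewrite mulmxBr mulmxA (_ : A0_mx k *m B0^T = - (B0 *m (A0_mx k)^T)).
    by rewrite mulNmx opprK -mulmxA -gaE.
  by apply/eqP; rewrite -addr_eq0 A0_trB0.
have [u uE] := redx_surj (col_mx ga de).
have [|v' ->] := @redx_eq _ v (d3 *m u); last by exists u, v'.
rewrite map_mxM redx_d3 -uE mul_block_col mul0mx addr0 -gaE -deE.
by rewrite addrC subrK vsubmxK.
Qed.

Let step3 (v : 'cV[P]_(3 + 6)) : d3 *m v = 0 ->
  exists u v', v = d4 *m u + X *: v'.
Proof.
move=> /(congr1 (map_mx redx)); rewrite map_mxM redx_d3 map_mx0.
rewrite -[map_mx redx v]vsubmxK mul_block_col mul0mx addr0 -(col_mx0 _ 8 8 1).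
set ga := usubmx _; set de := dsubmx _ => /eq_col_mx[E1 /trA0_mx_inj ga0].
move: E1; rewrite ga0 mulmx0 add0r => /ker_trD0_mx[c cE].
have [u uE] := redx_surj c.
have [|v' ->] := @redx_eq _ v (d4 *m u); last by exists u, v'.
rewrite map_mxM redx_d4 -uE mul_col_mx mul0mx -cE -[map_mx redx v]vsubmxK.
by rewrite -/ga -/de ga0.
Qed.

Let inj4 (v : 'cV[P]_1) : d4 *m v = 0 -> v = 0.
Proof.
(* The entry for y^2 reduces to the nonzero polynomial X_0^2. *)
rewrite /d4_mx mul_col_mx -(col_mx0 _ 3 6 1) => /eq_col_mx[_ /colP/(_ (idx2 0 0))].
rewrite !mxE big_ord1 !mxE => /eqP; rewrite mulf_eq0 => /orP[/eqP f0|/eqP v0].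
  have := congr1 redx f0; have /rowP/(_ (idx2 0 0)) := redx_f12; rewrite !mxE => ->.
  rewrite rmorph0 => /(congr1 (mcoeff (mon2 (idx2 0 0)))) /eqP.
  by rewrite mcoeffX eqxx mcoeff0 oner_eq0.
by apply/colP => i; rewrite ord1 v0 mxE.
Qed.

Let Phi_homog d f : f \is d.-homog -> d != 3%N -> Phi f = 0.
Proof. exact: Phi_D3. Qed.

Let lin2_homog (s t : U) : lin s * lin t \is 2.-homog.
Proof. by apply: (dhomogM (d := 1) (e := 1)); apply: lin_homog. Qed.

Let lin3_homog (r s t : U) : lin r * lin s * lin t \is 3.-homog.
Proof. by apply: (dhomogM (d := 2) (e := 1)); [exact: lin2_homog | exact: lin_homog]. Qed.

(** Phi vanishes outside degree 3, so only cofactors of degree 3 - d can be detected. *)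
Lemma ann_homog d f : f \is d.-homog ->
  (forall e g, (d + e = 3)%N -> g \is e.-homog -> Phi (f * g) = 0) -> ann Phi f.
Proof.
move=> hf Hf g; rewrite /contract.
rewrite [g](pihomog_partitionE (leqnn (mmeasure mdeg g))) mulr_sumr linear_sum.
rewrite big1 // => e _; have he := pihomogP mdeg e g.
have [de|de] := eqVneq (d + e)%N 3%N; first exact: Hf de he.
exact: Phi_homog (dhomogM hf he) de.
Qed.

Lemma ann_quad f : f \is 2.-homog -> (forall t, Phi (f * lin t) = 0) -> ann Phi f.
Proof.
move=> hf Hf; apply: (ann_homog hf) => -[|[|e]] g //.
by move=> _ /lin_surj[t ->].
Qed.

Let ann_cubic f : f \is 3.-homog -> Phi f = 0 -> ann Phi f.
Proof.
move=> hf Hf; apply: (ann_homog hf) => -[|e] g // _ hg.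
have -> : g = (g@_0%MM)%:MP.
  apply/mpolyP => m; rewrite mcoeffC.
  have [->|m0] := eqVneq m 0%MM; first by rewrite mulr1.
  by rewrite mulr0 (dhomog_nemf_coeff hg) // mdeg_eq0.
by rewrite mulrC mul_mpolyC linearZ /= Hf mulr0.
Qed.

Lemma annD f g : ann Phi f -> ann Phi g -> ann Phi (f + g).
Proof.
move=> Hf Hg h; have := Hf h; have := Hg h.
by rewrite /contract mulrDl linearD => -> ->; rewrite addr0.
Qed.

Lemma annM f g : ann Phi f -> ann Phi (g * f).
Proof. by move=> Hf h; rewrite /contract [g * f]mulrC -mulrA; exact: Hf. Qed.

Lemma ann_sum (I : finType) (F : I -> P) : (forall i, ann Phi (F i)) -> ann Phi (\sum_i F i).
Proof.
move=> HF; apply: (big_ind (ann Phi)) => [h|f g|i _]; [|exact: annD|exact: HF].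
by rewrite /contract mul0r linear0.
Qed.

Lemma ann_sharp (nu : 'Hom(U, k^o)) : nu x = 0 -> ann Phi (X ^+ 2 * lin (sharp nu)).
Proof.
move=> nux; apply: ann_cubic; first by rewrite expr2 lin3_homog.
by rewrite expr2 -triE triCA p_invE.
Qed.

Lemma f12_lin_comb q : q \is 2.-homog ->
  f12 x y z w Phi q = \sum_m (q@_(mon2 m))%:MP * f12 x y z w Phi 'X_[mon2 m].
Proof.
move=> hq; rewrite {1}(homog2_mon2 hq).
have L := f12_linear Phi x y z w.
have f0 : f12 x y z w Phi 0 = 0.
  by have := L (-1) 0 0; rewrite scaler0 addr0 scaleN1r addNr.
rewrite (big_morph (f12 x y z w Phi) (op1 := +%R) (id1 := 0)) //.
  by apply: eq_bigr => m _; rewrite -[_ *: _]addr0 L f0 addr0 mul_mpolyC.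
by move=> a b; have := L 1 a b; rewrite !scale1r.
Qed.

Lemma f12_homog q : q \is 2.-homog -> f12 x y z w Phi q \is 2.-homog.
Proof.
move=> /f12_lin_comb ->; rewrite rpred_sum // => m _; rewrite mul_mpolyC rpredZ //.
by rewrite (f12_mon2 dimU xs_x basis_yzw p_inj); apply: rpredB; apply: lin2_homog.
Qed.

Let ann_rel s t : ann Phi (lin s * lin t - X * lin (circ Phi x s t)).
Proof.
apply: ann_quad => [|r]; first by apply: rpredB; apply: lin2_homog.
by rewrite mulrBl linearB -!triE (circE p_inj) subrr.
Qed.

Lemma ann_f12 q : q \is 2.-homog -> ann Phi (f12 x y z w Phi q).
Proof.
move=> hq; rewrite f12_lin_comb //; apply: ann_sum => m; apply: annM.
by rewrite (f12_mon2 dimU xs_x basis_yzw p_inj); apply: ann_rel.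
Qed.

Lemma d1E (v : 'cV[P]_(3 + 6)) : (d1 *m v) 0 0 =
  \sum_i v (lshift 6 i) 0 * (X ^+ 2 * lin (sharp (nu_ i))) +
  \sum_m v (rshift 3 m) 0 * f12 x y z w Phi 'X_[mon2 m].
Proof.
rewrite mxE big_split_ord; congr (_ + _); apply: eq_bigr => i _.
  by rewrite row_mxEl !mxE /f11; ring.
by rewrite row_mxEr !mxE mulrC.
Qed.

Let mon2_homog m : 'X_[k, mon2 m] \is 2.-homog.
Proof. by rewrite dhomogX /= mon2E mdegD !mdeg1. Qed.

Lemma d1_ann (v : 'cV[P]_(3 + 6)) : ann Phi ((d1 *m v) 0 0).
Proof.
rewrite d1E; apply: annD; apply: ann_sum => i; apply: annM.
  exact/ann_sharp/(dualU0_x dimU xs_x basis_yzw).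
exact: ann_f12.
Qed.

(** The image of d_2 and multiples of X account for v up to a vector t in P (x) U_0^* that depends
    on four scalars. Applying d_1 and cancelling X puts a polynomial T in the ideal, and Phi reads
    the scalars off T. *)
Let step1 (v : 'cV[P]_(3 + 6)) : d1 *m v = 0 ->
  exists u v', v = d2 *m u + X *: v'.
Proof.
move=> dv; have := congr1 (map_mx redx) dv; rewrite map_mxM redx_d1 map_mx0.
rewrite -[map_mx redx v]vsubmxK mul_row_col mul0mx add0r.
pose a := usubmx (map_mx redx v); set q := dsubmx _ => /ker_f0_mx[be qE].
have [al [c [a0 aE]]] := coker_repP (a - B0 *m be).
have [u uE] := redx_surj (col_mx al be).
pose t : 'cV[P]_3 := \col_p ((p == 0)%:R * c%:MP * lin (u_ 0) + (a0 p)%:MP).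
have [|s vE] := @redx_eq _ v (d2 *m u + col_mx t 0).
  rewrite map_mxD map_mxM redx_d2 -uE mul_block_col mul0mx add0r -qE.
  rewrite map_col_mx map_mx0 add_col_mx addr0 -[map_mx redx v]vsubmxK -/a -/q.
  congr col_mx; rewrite -[LHS](subrK (B0 *m be)) aE addrAC; congr (_ + _).
  apply/colP => p; rewrite /t !mxE /= comp_mpolyD !rmorphM /=.
  by rewrite !comp_mpolyC rmorph_nat redx_u.
exists u, s; rewrite vE; congr (_ + _); rewrite -[RHS]addr0; congr (_ + _).
(* X T is the image under d_1 of t. *)
pose T : P := c%:MP * (X * lin (sharp (nu_ 0)) * lin (u_ 0)) +
  \sum_p (a0 p)%:MP * (X * lin (sharp (nu_ p))).
have Ts : T + (d1 *m s) 0 0 = 0.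
  apply: (mulfI x_neq0); rewrite mulr0.
  transitivity ((d1 *m v) 0 0); last by rewrite dv mxE.
  rewrite vE !mulmxDr mulmxA (d1_d2 dimU xs_x basis_yzw p_inj) mul0mx add0r.
  rewrite -scalemxAr [RHS]mxE [X in _ = _ + X]mxE mulrDr; congr (_ + _).
  rewrite d1E [X in _ = _ + X]big1 ?addr0 => [|m _]; last by rewrite col_mxEd mxE mul0r.
  rewrite /T mulrDr.
  have -> : X * (\sum_p (a0 p)%:MP * (X * lin (sharp (nu_ p)))) =
      \sum_p X * ((a0 p)%:MP * (X * lin (sharp (nu_ p)))) by exact: mulr_sumr.
  under [RHS]eq_bigr do rewrite col_mxEu mxE mulrDl.
  rewrite [RHS]big_split /=; congr (_ + _); last by apply: eq_bigr => p _; ring.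
  rewrite [RHS](bigD1 0) //= ?eqxx [X in _ = _ + X]big1 ?addr0; last first.
    by move=> p /negPf ->; rewrite !mul0r.
  by rewrite /=; ring.
have annT g : Phi (T * g) = 0.
  have := d1_ann s g; rewrite /contract => H.
  by rewrite -[T](addrK ((d1 *m s) 0 0)) Ts sub0r mulNr linearN /= H oppr0.
(* For degree reasons only the first term of T pairs with 1, and b(sh_0, u_0) = 1. *)
have c0 : c = 0.
  have := annT 1; rewrite mulr1 linearD mul_mpolyC linearZ -triE /= p_invE //.
  rewrite (dualU0_basU0 dimU xs_x basis_yzw) eqxx linear_sum big1 ?addr0 => [|p _].
    by rewrite mulr1.
  by rewrite mul_mpolyC linearZ /= (Phi_homog (lin2_homog _ _)) ?mulr0.
have a00 p : a0 p = 0.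
  have := annT (lin (u_ p)); rewrite /T c0 mpolyC0 mul0r add0r mulr_suml linear_sum.
  rewrite (bigD1 p) //= big1 ?addr0 => [|p' /negPf pp].
    rewrite mul_mpolyC -scalerAl linearZ -triE /= p_invE //.
    by rewrite (dualU0_basU0 dimU xs_x basis_yzw) eqxx mulr1.
  rewrite mul_mpolyC -scalerAl linearZ -triE /= p_invE //.
  by rewrite (dualU0_basU0 dimU xs_x basis_yzw) pp mulr0.
rewrite (_ : t = 0) ?col_mx0 //; apply/colP => p.
by rewrite !mxE c0 a00 mpolyC0 mulr0 mul0r addr0.
Qed.

Let scal_homog d (c : P) (f : P) (a : k) : c = a%:MP -> f \is d.-homog -> c * f \is d.-homog.
Proof. by move=> ->; rewrite mul_mpolyC; apply: rpredZ. Qed.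

Let lin1_scal (u : U) (a : k) : lin u * a%:MP \is 1.-homog.
Proof. by rewrite mulrC; apply: (scal_homog (a := a)); rewrite ?lin_homog. Qed.

Let nat_mpolyC (n : nat) : n%:R = (n%:R)%:MP :> P.
Proof. by rewrite rmorph_nat. Qed.

Let A_homog p a : Amx p a \is 1.-homog.
Proof.
have [g ->] := A_mx_modx dimU xs_x basis_yzw p_inj p a.
apply: rpredD; last exact: lin1_scal.
apply: rpred_sum => i _; apply: rpred_sum => j _; apply: rpredZ.
by apply: (scal_homog (nat_mpolyC _)); apply: lin_homog.
Qed.

Let D_homog m a : Dmx m a \is 1.-homog.
Proof.
have [g ->] := D_mx_modx dimU xs_x basis_yzw p_inj m a.
apply: rpredD; last exact: lin1_scal.
apply: rpred_sum => i _; apply: rpred_sum => j _; apply: rpredZ.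
by apply: rpredB; rewrite (nat_mpolyC (_ == _)); apply: lin1_scal.
Qed.

Let B_homog q a : Bmx q a \is 0.-homog.
Proof. by rewrite mxE -[_%:MP]mulr1 mul_mpolyC rpredZ // dhomog1. Qed.

Let xC_homog m a : (X ^+ 2 *: Cmx) m a \is 2.-homog.
Proof.
rewrite !mxE mulrC; apply: scal_homog (erefl _) _.
exact: (lin2_homog x x).
Qed.

Let xf11_homog i j : (X *: f11mx) i j \is 3.-homog.
Proof. by rewrite !mxE /f11 mulrA; apply: lin3_homog. Qed.

Let f12mx_homog i m : f12mx i m \is 2.-homog.
Proof. by rewrite mxE; apply: f12_homog. Qed.

Lemma d1_homogeneous : homogeneous_mx (fun=> 0%N) (@shifts 3 6 3 2) d1.
Proof.
move=> i j _; rewrite ord1 subn0; split=> //.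
case: (split_ordP j) => j' ->; rewrite ?row_mxEl ?row_mxEr ?shiftsl ?shiftsr //.
Qed.

Lemma d2_homogeneous : homogeneous_mx (@shifts 3 6 3 2) (@shifts 8 8 4 3) d2.
Proof.
move=> i j _; case: (split_ordP i) => i' ->; case: (split_ordP j) => j' ->;
by rewrite ?block_mxEul ?block_mxEur ?block_mxEdl ?block_mxEdr !(shiftsl, shiftsr).
Qed.

Lemma d3_homogeneous : homogeneous_mx (@shifts 8 8 4 3) (@shifts 3 6 4 5) d3.
Proof.
move=> i j _; case: (split_ordP i) => i' ->; case: (split_ordP j) => j' ->;
by rewrite ?block_mxEul ?block_mxEur ?block_mxEdl ?block_mxEdr !(shiftsl, shiftsr)
  -?trmxZ trmxE.
Qed.

Lemma d4_homogeneous : homogeneous_mx (@shifts 3 6 4 5) (fun=> 7%N) d4.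
Proof.
move=> i j _; case: (split_ordP i) => i' ->;
by rewrite ?col_mxEu ?col_mxEd !(shiftsl, shiftsr) -?trmxZ trmxE.
Qed.

Let x_homog : X \is 1.-homog. Proof. exact: lin_homog. Qed.

Let exact12 : exact_at d1 d2.
Proof.
exact: (exact_at_by_division d1_homogeneous d2_homogeneous
  (d1_d2 dimU xs_x basis_yzw p_inj) x_neq0 x_homog step1).
Qed.

Let exact23 : exact_at d2 d3.
Proof.
exact: (exact_at_by_division d2_homogeneous d3_homogeneous
  (d2_d3 dimU xs_x basis_yzw p_inj) x_neq0 x_homog step2).
Qed.

Let exact34 : exact_at d3 d4.
Proof.
exact: (exact_at_by_division d3_homogeneous d4_homogeneous
  (d3_d4 dimU xs_x basis_yzw p_inj) x_neq0 x_homog step3).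
Qed.

Let J (f : P) : Prop := exists v : 'cV[P]_(3 + 6), f = (d1 *m v) 0 0.

Let JD f g : J f -> J g -> J (f + g).
Proof. by move=> [v ->] [v' ->]; exists (v + v'); rewrite mulmxDr [RHS]mxE. Qed.

Let JM f g : J g -> J (f * g).
Proof. by move=> [v ->]; exists (f *: v); rewrite -scalemxAr [RHS]mxE. Qed.

Let JN f : J f -> J (- f).
Proof. by move=> Jf; rewrite -mulN1r; apply: JM. Qed.

Let J_sharp i : J (X ^+ 2 * lin (sharp (nu_ i))).
Proof.
exists (delta_mx (lshift 6 i) 0); rewrite -colE mxE row_mxEl !mxE /f11; ring.
Qed.

Let J_f12 m : J (f12 x y z w Phi 'X_[mon2 m]).
Proof. by exists (delta_mx (rshift 3 m) 0); rewrite -colE mxE row_mxEr mxE. Qed.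

Let J_sum (I : finType) (F : I -> P) : (forall i, J (F i)) -> J (\sum_i F i).
Proof.
move=> HF; apply: (big_ind J) => [|f g|i _]; [|exact: JD|exact: HF].
by rewrite -[0](mul0r (X ^+ 2 * lin (sharp (nu_ 0)))); apply/JM/J_sharp.
Qed.

Let proj2_homog s t : proj s * proj t \is 2.-homog.
Proof.
apply: (dhomogM (d := 1) (e := 1)); rewrite /projU0 rpred_sum // => i _;
by rewrite rpredZ // dhomogX /= mdeg1.
Qed.

Let J_rel s t : J (lin s * lin t - X * lin (circ Phi x s t)).
Proof.
rewrite -(f12_proj dimU xs_x basis_yzw p_inj s t).
rewrite (f12_lin_comb (proj2_homog s t)); apply: J_sum => m.
exact/JM/J_f12.
Qed.

Local Notation e := (sharp xs).

(** In the basis e, sh_i the coordinate of t along e is b(t, x), and x^2 sh_i is a generator. *)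
Let J_e t : J (X ^+ 2 * lin t - (tri Phi x t x)%:MP * (X ^+ 2 * lin e)).
Proof.
rewrite [X in _ * lin X - _](sharp_decomp dimU xs_x basis_yzw p_inj t).
rewrite (linearD (@lin k U)) linearZ /= (linear_sum (@lin k U)) mulrDr -scalerAr.
rewrite mul_mpolyC addrC addrA addNr add0r.
rewrite mulr_sumr; apply: J_sum => i.
by rewrite linearZ /= -mul_mpolyC mulrCA; apply/JM/J_sharp.
Qed.

(** The product v of sh_0 and u_0 has b(v, x) = 1, so x^2 v and x^2 e agree modulo J; and x^3 v is
    congruent to u_0 (x^2 sh_0), a multiple of a generator. *)
Let J_x3 : J (X ^+ 3 * lin e).
Proof.
pose v := circ Phi x (sharp (nu_ 0)) (u_ 0).
have vx : tri Phi x v x = 1.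
  by rewrite circE // triCA triC p_invE // (dualU0_basU0 dimU xs_x basis_yzw).
have Jv : J (X ^+ 3 * lin v).
  have -> : X ^+ 3 * lin v = lin (u_ 0) * (X ^+ 2 * lin (sharp (nu_ 0))) -
      X ^+ 2 * (lin (sharp (nu_ 0)) * lin (u_ 0) - X * lin v) by ring.
  by apply: JD; [apply/JM/J_sharp | apply/JN/JM/J_rel].
have -> : X ^+ 3 * lin e = X ^+ 3 * lin v
    - X * (X ^+ 2 * lin v - (tri Phi x v x)%:MP * (X ^+ 2 * lin e)).
  by rewrite vx mpolyC1; ring.
by apply: JD => //; apply/JN/JM/J_e.
Qed.

Let reprJ f : exists (c0 : k) (u1 u2 : U) (c3 : k),
  J (f - (c0%:MP + lin u1 + X * lin u2 + c3%:MP * (X ^+ 2 * lin e))).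
Proof.
elim/mpoly_ind_mulX: f => [c|f g [c0 [u1 [u2 [c3 Jf]]]] [d0 [v1 [v2 [d3' Jg]]]]|].
- exists c, 0, 0, 0; rewrite !linear0 mpolyC0 mulr0 mul0r !addr0 subrr.
  by rewrite -[0](mul0r (X ^+ 2 * lin (sharp (nu_ 0)))); apply/JM/J_sharp.
- exists (c0 + d0), (u1 + v1), (u2 + v2), (c3 + d3').
  have linD u v : lin (u + v) = lin u + lin v :> P by exact: linearD.
  have := JD Jf Jg; congr J; rewrite !mpolyCD !linD.
  by move: (lin u1) (lin v1) (lin u2) (lin v2) (lin e) X => *; ring.
- move=> f i [c0 [u1 [u2 [c3 Jf]]]]; rewrite -lin_vbasis; set t := (vbasis _)`_i.
  (* Modulo J, multiplication by t sends c0 to c0 t, u1 to x (t o u1), x u2 to b(t o u2, x) x^2 e,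
     and x^2 e to x^3 (t o e), a multiple of x^3 e and so zero. *)
  exists 0, (c0 *: t), (circ Phi x t u1), (tri Phi x (circ Phi x t u2) x).
  have Jxt : J (X ^+ 3 * lin (circ Phi x t e)).
    have -> : X ^+ 3 * lin (circ Phi x t e) = X * (X ^+ 2 * lin (circ Phi x t e)
        - (tri Phi x (circ Phi x t e) x)%:MP * (X ^+ 2 * lin e))
        + (tri Phi x (circ Phi x t e) x)%:MP * (X ^+ 3 * lin e) by ring.
    by apply: JD; [apply/JM/J_e | apply/JM/J_x3].
  have := JD (JM (lin t) Jf) (JD (J_rel t u1) (JD (JM X (J_rel t u2))
    (JD (J_e (circ Phi x t u2)) (JM c3%:MP (JD (JM (X ^+ 2) (J_rel t e)) Jxt))))).
  congr J; rewrite linearZ /= mpolyC0 -mul_mpolyC; ring.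
Qed.

(** Pairing a normal form with 1, with t, with x t and with x^2 e gives c3, u2, u1 and c0 in turn,
    by nondegeneracy of b and b(x, e) = 1. *)
Lemma annP f : ann Phi f <-> J f.
Proof.
split=> [annf|[v ->]]; last exact: d1_ann.
have [c0 [u1 [u2 [c3 Jf]]]] := reprJ f.
set r := c0%:MP + _ + _ + _ in Jf.
have annr g : Phi (r * g) = 0.
  have [v rv] := Jf; have := d1_ann v g; have := annf g; rewrite /contract -rv => E.
  by rewrite mulrBl linearB /= E sub0r => /eqP; rewrite oppr_eq0 => /eqP.
have xe : tri Phi x x e = 1 by rewrite triCA p_invE // xs_x.
have lin4_homog (q s t v : U) : lin q * lin s * lin t * lin v \is 4.-homog.
  by apply: (dhomogM (d := 3) (e := 1)); [exact: lin3_homog | exact: lin_homog].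
have one : Phi 1 = 0 by apply: (Phi_homog (d := 0)); rewrite ?dhomog1.
have deg1 s : Phi (lin s) = 0 by apply: (Phi_homog (d := 1)); rewrite ?lin_homog.
have deg2 s t : Phi (lin s * lin t) = 0 by apply: (Phi_homog (d := 2)); rewrite ?lin2_homog.
have PhiZ a g : Phi (a%:MP * g) = a * Phi g by rewrite mul_mpolyC linearZ.
have c30 : c3 = 0.
  have := annr 1; rewrite mulr1 /r !linearD PhiZ -[c0%:MP]mulr1 PhiZ /= one deg1 deg2.
  by rewrite expr2 -triE xe mulr0 !add0r mulr1.
have u20 : u2 = 0.
  apply: p_inj => t; have := annr (lin t); rewrite /r c30 mpolyC0 mul0r addr0.
  by rewrite !mulrDl !linearD PhiZ /= deg1 deg2 mulr0 !add0r -triE.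
have u10 : u1 = 0.
  apply: p_inj => t; have := annr (X * lin t).
  rewrite /r c30 u20 mpolyC0 mul0r linear0 mulr0 !addr0.
  rewrite mulrDl linearD PhiZ /= deg2 mulr0 add0r mulrCA mulrA -triE //.
have c00 : c0 = 0.
  have := annr (X ^+ 2 * lin e); rewrite /r c30 u20 u10 mpolyC0 mul0r !linear0 mulr0 !addr0.
  by rewrite PhiZ expr2 -triE xe mulr1.
by move: Jf; rewrite /r c30 c00 u20 u10 mpolyC0 mul0r !linear0 mulr0 !addr0 subr0.
Qed.

Lemma resolution : free_resolution (ann Phi) d1 d2 d3 d4.
Proof.
split; [|exact: exact12|exact: exact23|exact: exact34|exact: inj4].
move=> f; rewrite annP; split=> -[v E]; exists v.
  by apply/matrixP => i j; rewrite !ord1 -E mxE eqxx.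
by rewrite -E mxE eqxx.
Qed.

End Exactness.

(** * Ideals generated by a set *)

Section Ideals.

Variable R : comNzRingType.
Implicit Types (S I : R -> Prop) (f g : R).

Lemma ideal_ofD S f g : ideal_of S f -> ideal_of S g -> ideal_of S (f + g).
Proof.
move=> [n [c [a [Sa ->]]]] [m [d [b [Sb ->]]]].
exists (n + m)%N, (fun i => match split i with inl j => c j | inr l => d l end),
  (fun i => match split i with inl j => a j | inr l => b l end); split.
  by move=> i; case: (split i).
rewrite big_split_ord; congr (_ + _); apply: eq_bigr => i _.
  by rewrite (unsplitK (inl i)).
by rewrite (unsplitK (inr i)).
Qed.

Lemma ideal_ofM S f g : ideal_of S g -> ideal_of S (f * g).
Proof.
move=> [n [c [a [Sa ->]]]]; exists n, (fun i => f * c i), a; split=> //.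
by rewrite mulr_sumr; apply: eq_bigr => i _; rewrite mulrA.
Qed.

Lemma ideal_of_gen S f : S f -> ideal_of S f.
Proof.
by move=> Sf; exists 1%N, (fun=> 1), (fun=> f); split=> //; rewrite big_ord1 mul1r.
Qed.

Lemma ideal_of_sum S (J : finType) (F : J -> R) :
  (forall j, ideal_of S (F j)) -> ideal_of S (\sum_j F j).
Proof.
move=> SF; apply: (big_ind (ideal_of S)) => [|f g|j _]; [|exact: ideal_ofD|exact: SF].
exists 0%N, (fun=> 0), (fun=> 0); split; first by case.
by rewrite big_ord0.
Qed.

Lemma ideal_of_sub S I :
    I 0 -> (forall f g, I f -> I g -> I (f + g)) -> (forall f g, I g -> I (f * g)) ->
    (forall f, S f -> I f) ->
  forall f, ideal_of S f -> I f.
Proof.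
move=> I0 ID IM SI _ [n [c [a [Sa ->]]]].
by apply: (big_ind I) => // i _; apply/IM/SI/Sa.
Qed.

Lemma ideal_of_range n (g : 'I_n -> R) f : ideal_of (fun f => exists i, f = g i) f ->
  exists c : 'I_n -> R, f = \sum_i c i * g i.
Proof.
apply: (@ideal_of_sub _ (fun f => exists c : 'I_n -> R, f = \sum_i c i * g i)).
- by exists (fun=> 0); rewrite big1 // => i _; rewrite mul0r.
- move=> _ _ [c ->] [d ->]; exists (fun i => c i + d i).
  by rewrite -big_split; apply: eq_bigr => i _; rewrite mulrDl.
- move=> a _ [c ->]; exists (fun i => a * c i).
  by rewrite mulr_sumr; apply: eq_bigr => i _; rewrite mulrA.
- move=> _ [i ->]; exists (fun j => (j == i)%:R).
  by rewrite (bigD1 i) //= eqxx mul1r big1 ?addr0 // => j /negPf ->; rewrite mul0r.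
Qed.

End Ideals.

Lemma homogeneous_mx_const (k : fieldType) (r m n : nat) s t
    (d : 'M[{mpoly k[r]}]_(m, n)) i j :
  homogeneous_mx s t d -> s i != t j -> (d i j)@_0%MM = 0.
Proof.
move=> hd st; have [->|/hd[le_st hij]] := eqVneq (d i j) 0; first by rewrite mcoeff0.
apply: (dhomog_nemf_coeff hij); rewrite /= mdeg0 eq_sym subn_eq0 -ltnNge.
by rewrite ltn_neqAle st.
Qed.

(** If multiplication by x is injective on linear forms, the quadric x u lies in ann Phi and hence
    so does u. If it is surjective onto quadrics, every quadric is some x t modulo ann Phi, so u
    pairs to zero with all of them. *)
Lemma weak_Lefschetz_inj (k : fieldType) (U : vectType k)
    (Phi : {scalar {mpoly k[\dim {: U}]}}) (x : U) : in_D 3 Phi ->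
    (forall u : U, ann Phi (lin u) -> u = 0) -> weak_Lefschetz (ann Phi) x ->
  forall u : U, (forall t, tri Phi x u t = 0) -> u = 0.
Proof.
move=> Phi_D3 no_lin WL u xu; apply: no_lin; case: (WL 1%N) => [inj|surj].
  apply: inj; first exact: lin_homog.
  apply: ann_quad => // [|t]; last by rewrite -triE.
  by apply: (dhomogM (d := 1) (e := 1)); apply: lin_homog.
apply: (ann_homog Phi_D3 (lin_homog u)) => -[|[|[|e]]] g // _ /surj[f /lin_surj[t ->] annf].
rewrite -[g](subrK (lin x * lin t)) mulrDr linearD [lin u * (lin x * _)]mulrA.
rewrite [lin u * lin x]mulrC -triE xu addr0 mulrC.
exact: annf.
Qed.

(** * Minimality and the number of generators *)

Section Generators.

Variables (k : fieldType) (U : vectType k) (dimU : \dim {: U} = 4%N).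
Local Notation P := {mpoly k[\dim {: U}]}.
Variables (Phi : {scalar P}) (x : U) (xs : 'Hom(U, k^o)) (xs_x : xs x = 1).
Variables (y z w : U).
Hypothesis basis_yzw : basis_of (lker xs) [:: y; z; w].
Hypothesis p_inj : forall u : U, (forall t, tri Phi x u t = 0) -> u = 0.
Hypothesis Phi_D3 : in_D 3 Phi.

Local Notation nu_ := (dualU0 x y z w).
Local Notation B := (B_mx x y z w Phi).
Local Notation d1 := (d1_mx x y z w Phi).
Local Notation d2 := (d2_mx x y z w Phi).
Local Notation d3 := (d3_mx x y z w Phi).
Local Notation d4 := (d4_mx x y z w Phi).

Let g1 i : P := lin x ^+ 2 * lin (p_inv x Phi (nu_ i)).
Let g2 m : P := f12 x y z w Phi 'X_[mon2 m].

Let res := resolution dimU xs_x basis_yzw p_inj Phi_D3.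

Let annE f : ann Phi f -> exists v : 'cV[P]_(3 + 6), f = (d1 *m v) 0 0.
Proof.
by case: res => /(_ f) [H _] _ _ _ _ /H [v E]; exists v; rewrite -E mxE eqxx.
Qed.

Let ann0 : ann Phi 0.
Proof. by move=> h; rewrite /contract mul0r linear0. Qed.

Let ann_g1 i : ann Phi (g1 i).
Proof. exact/ann_sharp/(dualU0_x dimU xs_x basis_yzw). Qed.

Let ann_g2 m : ann Phi (g2 m).
Proof.
by apply: (ann_f12 dimU xs_x basis_yzw) => //; rewrite dhomogX /= mon2E mdegD !mdeg1.
Qed.

Let ideal_gens (S : P -> Prop) f : (forall i, ideal_of S (g1 i)) ->
  (forall m, ideal_of S (g2 m)) -> ann Phi f -> ideal_of S f.
Proof.
move=> S1 S2 /annE[v ->]; rewrite d1E; apply: ideal_ofD; apply: ideal_of_sum => i.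
  exact/ideal_ofM/S1.
exact/ideal_ofM/S2.
Qed.

Lemma ann_generates : generates
  (fun f => (exists2 nu : 'Hom(U, k^o), nu x = 0 & f = lin x ^+ 2 * lin (p_inv x Phi nu)) \/
            (exists2 u2 : {mpoly k[3]}, u2 \is 2.-homog & f = f12 x y z w Phi u2))
  (ann Phi).
Proof.
move=> f; split.
  apply: ideal_gens => [i|m]; apply: ideal_of_gen; [left | right].
    by exists (nu_ i) => //; apply: (dualU0_x dimU xs_x basis_yzw).
  by exists 'X_[mon2 m] => //; rewrite dhomogX /= mon2E mdegD !mdeg1.
apply: (ideal_of_sub ann0 (@annD _ _ Phi)) => [a b|_ [[nu nux ->]|[q hq ->]]]; first exact: annM.
  exact: ann_sharp.
exact: (ann_f12 dimU xs_x basis_yzw).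
Qed.

Let hom1 := d1_homogeneous dimU xs_x basis_yzw p_inj.
Let hom2 := d2_homogeneous dimU xs_x basis_yzw p_inj.
Let hom3 := d3_homogeneous dimU xs_x basis_yzw p_inj.
Let hom4 := d4_homogeneous dimU xs_x basis_yzw p_inj.

(** B and its transpose are the only blocks between summands generated in equal degrees: degree 3 in
    d_2 and degree 4 in d_3. *)
Lemma minimal_iff : minimal_complex d1 d2 d3 d4 <-> B = 0.
Proof.
split=> [[_ min2 _ _]|B0].
  apply/matrixP => q a; have := min2 (lshift 6 q) (rshift 8 a).
  by rewrite block_mxEur !mxE mcoeffC eqxx mulr1.
split=> i j.
- by apply: (homogeneous_mx_const hom1); case: (split_ordP j) => j' ->; rewrite ?shiftsl ?shiftsr.
- case: (split_ordP i) => i' ->; case: (split_ordP j) => j' ->;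
    try by apply: (homogeneous_mx_const hom2); rewrite ?shiftsl ?shiftsr.
  by rewrite block_mxEur B0 !mxE mpolyC0 mcoeff0.
- case: (split_ordP i) => i' ->; case: (split_ordP j) => j' ->;
    try by apply: (homogeneous_mx_const hom3); rewrite ?shiftsl ?shiftsr.
  by rewrite block_mxEul B0 !mxE mpolyC0 mcoeff0.
- by apply: (homogeneous_mx_const hom4); case: (split_ordP i) => i' ->; rewrite ?shiftsl ?shiftsr.
Qed.

Let d2_const : map_mx (mcoeff 0%MM) d2 = block_mx 0 B 0 0.
Proof.
apply/matrixP => i j; rewrite mxE.
case: (split_ordP i) => i' ->; case: (split_ordP j) => j' ->.
- rewrite [in RHS]block_mxEul [RHS]mxE.
  by apply: (homogeneous_mx_const hom2); rewrite ?shiftsl ?shiftsr.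
- by rewrite [in RHS]block_mxEur block_mxEur [map_mx _ _ _ _]mxE mcoeffC eqxx mulr1.
- rewrite [in RHS]block_mxEdl [RHS]mxE.
  by apply: (homogeneous_mx_const hom2); rewrite ?shiftsl ?shiftsr.
- rewrite [in RHS]block_mxEdr [RHS]mxE.
  by apply: (homogeneous_mx_const hom2); rewrite ?shiftsl ?shiftsr.
Qed.

Let rank_d2_const : (\rank (map_mx (mcoeff 0%MM) d2) <= \rank B)%N.
Proof.
have -> : map_mx (mcoeff 0%MM) d2 = col_mx 1%:M 0 *m (B *m row_mx 0 1%:M).
  by rewrite mul_mx_row mulmx0 mulmx1 mul_col_mx mul1mx mul0mx d2_const block_mxEv row_mx0.
by rewrite (leq_trans (mxrankM_maxr _ _)) // mxrankM_maxl.
Qed.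

(** V writes the g_i through the entries of d_1 and C does the reverse. Evaluation at the origin is
    a ring morphism, so the g_i need not be homogeneous. *)
Lemma min_gens_lower n (g : 'I_n -> P) :
  generates (fun f => exists i, f = g i) (ann Phi) -> (9 - \rank B <= n)%N.
Proof.
move=> gen; rewrite leq_subLR.
have [v vE] : exists v : 'I_n -> 'cV[P]_(3 + 6), forall i, g i = (d1 *m v i) 0 0.
  apply: (@fin_all_exists _ _ (fun i v => g i = (d1 *m v) 0 0)) => i.
  by apply/annE/gen/ideal_of_gen; exists i.
have [c cE] : exists c : 'I_(3 + 6) -> 'I_n -> P, forall j, d1 0 j = \sum_i c j i * g i.
  apply: (@fin_all_exists _ _ (fun j c => d1 0 j = \sum_i c i * g i)) => j.
  apply/ideal_of_range/gen.
  have := d1_ann dimU xs_x basis_yzw p_inj Phi_D3 (delta_mx j 0).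
  by rewrite -colE mxE.
pose V : 'M[P]_(3 + 6, n) := \matrix_(j, i) v i j 0.
pose C : 'M[P]_(n, 3 + 6) := \matrix_(i, j) c j i.
have d1VC : d1 *m (1%:M - V *m C) = 0.
  rewrite mulmxBr mulmx1 mulmxA; apply/eqP; rewrite subr_eq0; apply/eqP/matrixP => i j.
  rewrite ord1 cE [RHS]mxE; apply: eq_bigr => l _.
  rewrite vE mulrC; congr (_ * _); last by rewrite mxE.
  by rewrite [LHS]mxE [RHS]mxE; apply: eq_bigr => h _; rewrite [V _ _]mxE.
have [W WE] : exists W : 'I_(3 + 6) -> 'cV[P]_(8 + 8), forall j,
    col j (1%:M - V *m C) = d2 *m W j.
  apply: (@fin_all_exists _ _ (fun j W => col j (1%:M - V *m C) = d2 *m W)) => j.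
  case: res => _ /(_ (col j (1%:M - V *m C))) [H _] _ _ _; apply: H.
  by rewrite colE mulmxA d1VC mul0mx.
have E : 1%:M = V *m C + d2 *m (\matrix_(i, j) W j i 0).
  apply/eqP; rewrite addrC -subr_eq; apply/eqP/matrixP => i j.
  have /colP/(_ i) := WE j; rewrite mxE => ->.
  by rewrite [LHS]mxE [RHS]mxE; apply: eq_bigr => h _; congr (_ * _); rewrite mxE.
have := congr1 (map_mx (mcoeff 0%MM)) E.
rewrite map_mx1 map_mxD !map_mxM => /(congr1 mxrank); rewrite mxrank1 => E9.
apply: (@leq_trans (3 + 6)) => //; apply: (leq_trans (eq_leq E9)).
rewrite [(\rank B + n)%N]addnC (leq_trans (mxrank_add _ _)) // leq_add //.
  by rewrite (leq_trans (mxrankM_maxl _ _)) // rank_leq_col.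
by rewrite (leq_trans (mxrankM_maxl _ _)).
Qed.

(** A column of d_2 through B and D is a relation: the constant combinations of cubics given by the
    columns of B lie in the ideal of the quadrics. *)
Let rel_B a : \sum_q (B q a)%:MP * g1 q + \sum_m d2 (rshift 3 m) (rshift 8 a) * g2 m = 0.
Proof.
have : (d1 *m col (rshift 8 a) d2) 0 0 = 0.
  by rewrite colE mulmxA (d1_d2 dimU xs_x basis_yzw p_inj) mul0mx mxE.
rewrite d1E => E; rewrite -[RHS]E; congr (_ + _); apply: eq_bigr => i _; congr (_ * _).
  by rewrite [RHS]mxE block_mxEur [RHS]mxE.
by rewrite [RHS]mxE.
Qed.

(* The quadrics, and as many of the cubics as the corank of B. *)
Lemma min_gens_upper : exists g : 'I_(9 - \rank B) -> P,
  generates (fun f => exists i, f = g i) (ann Phi).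
Proof.
(* A complement in k^3 of the column space of B. *)
pose K := (B^T)^C%MS; have rK : \rank K = (3 - \rank B)%N by rewrite mxrank_compl mxrank_tr.
have -> : (9 - \rank B = \rank K + 6)%N.
  by rewrite rK addnBAC // rank_leq_row.
pose gl i : P := \sum_j (row_base K i j)%:MP * g1 j.
exists (fun i => match split i with inl j => gl j | inr m => g2 m end) => f; split; last first.
  apply: (ideal_of_sub ann0 (@annD _ _ Phi)) => [a b|_ [i ->]]; first exact: annM.
  case: (split i) => [j|m]; last exact: ann_g2.
  by apply: ann_sum => l; apply/annM/ann_g1.
set S := fun f => _; have S2 m : ideal_of S (g2 m).
  by apply: ideal_of_gen; exists (rshift _ m); rewrite (unsplitK (inr m)).
apply: ideal_gens => // j.
(* The j-th basis vector of k^3 splits into a part in the column space of B, handled by [rel_B], and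
   a part in K. *)
have /sub_addsmxP[[b c] bc] : (@delta_mx k 1 3 0 j <= B^T + row_base K)%MS.
  by rewrite (adds_eqmx (eqmx_refl _) (eq_row_base K)) submx_full ?addsmx_compl_full.
have -> : g1 j = \sum_a (b 0 a)%:MP * (\sum_q (B q a)%:MP * g1 q) +
    \sum_i (c 0 i)%:MP * gl i.
  transitivity (\sum_q ((b *m B^T + c *m row_base K) 0 q)%:MP * g1 q).
    rewrite -bc (bigD1 j) //= mxE !eqxx mpolyC1 mul1r big1 ?addr0 // => q /negPf qj.
    by rewrite mxE qj andbF mpolyC0 mul0r.
  transitivity (\sum_q (((b *m B^T) 0 q)%:MP * g1 q + ((c *m row_base K) 0 q)%:MP * g1 q)).
    by apply: eq_bigr => q _; rewrite addmxE mpolyCD mulrDl.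
  rewrite big_split /=; congr (_ + _).
    under eq_bigr do rewrite mxE rmorph_sum mulr_suml.
    rewrite exchange_big /=; apply: eq_bigr => a _; rewrite mulr_sumr.
    by apply: eq_bigr => q _; rewrite trmxE rmorphM mulrA.
  under eq_bigr do rewrite mxE rmorph_sum mulr_suml.
  rewrite exchange_big /=; apply: eq_bigr => a _; rewrite mulr_sumr.
  by apply: eq_bigr => q _; rewrite rmorphM mulrA.
apply: ideal_ofD; apply: ideal_of_sum => i; apply: ideal_ofM; last first.
  by apply: ideal_of_gen; exists (lshift _ i); rewrite (unsplitK (inl i)).
have -> : \sum_q (B q i)%:MP * g1 q = -1 * \sum_m d2 (rshift 3 m) (rshift 8 i) * g2 m.
  by apply/eqP; rewrite mulN1r -addr_eq0 rel_B.
by apply/ideal_ofM/ideal_of_sum => m; apply/ideal_ofM/S2.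
Qed.

End Generators.

Theorem theorem5p1 (k : fieldType) (U : vectType k) (dimU : \dim {: U} = 4%N)
    (Phi : {scalar {mpoly k[\dim {: U}]}}) (Phi_D3 : in_D 3 Phi)
    (no_linear_form : forall u : U, ann Phi (lin u) -> u = 0)
    (x : U) (x_weak_Lefschetz : weak_Lefschetz (ann Phi) x)
    (xs : 'Hom(U, k^o)) (xs_x : xs x = 1)
    (y z w : U) (basis_yzw : basis_of (lker xs) [:: y; z; w]) :
  let B := B_mx x y z w Phi in
  let d1 := d1_mx x y z w Phi in
  let d2 := d2_mx x y z w Phi in
  let d3 := d3_mx x y z w Phi in
  let d4 := d4_mx x y z w Phi in
  [/\ generates
        (fun f =>
           (exists2 nu : 'Hom(U, k^o), nu x = 0 &
              f = lin x ^+ 2 * lin (p_inv x Phi nu)) \/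
           (exists2 u2 : {mpoly k[3]}, u2 \is 2.-homog &
              f = f12 x y z w Phi u2))
        (ann Phi),
      free_resolution (ann Phi) d1 d2 d3 d4,
      [/\ homogeneous_mx (fun=> 0%N) (@shifts 3 6 3 2) d1,
          homogeneous_mx (@shifts 3 6 3 2) (@shifts 8 8 4 3) d2,
          homogeneous_mx (@shifts 8 8 4 3) (@shifts 3 6 4 5) d3 &
          homogeneous_mx (@shifts 3 6 4 5) (fun=> 7%N) d4],
      minimal_complex d1 d2 d3 d4 <-> B = 0 &
      min_num_generators (ann Phi) (9 - \rank B)].
Proof.
have p_inj := weak_Lefschetz_inj Phi_D3 no_linear_form x_weak_Lefschetz.
move=> B d1 d2 d3 d4; split.
- exact: (ann_generates dimU xs_x basis_yzw p_inj Phi_D3).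
- exact: (resolution dimU xs_x basis_yzw p_inj Phi_D3).
- split; [exact: (d1_homogeneous dimU xs_x basis_yzw p_inj)
        | exact: (d2_homogeneous dimU xs_x basis_yzw p_inj)
        | exact: (d3_homogeneous dimU xs_x basis_yzw p_inj)
        | exact: (d4_homogeneous dimU xs_x basis_yzw p_inj)].
- exact: (minimal_iff dimU xs_x basis_yzw p_inj).
- split; first exact: (min_gens_upper dimU xs_x basis_yzw p_inj Phi_D3).
  exact: (min_gens_lower dimU xs_x basis_yzw p_inj Phi_D3).
Qed.
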